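(* Let $s_0\in\mathbb{C}$ be any one of the six roots of the equation $$2^{15}\cdot 3^{3}\, s^{6} - 2^{6}\cdot 3^{3}\cdot 5\, s^{3} + 5^{2}=0,$$ and let $t_0\in\mathbb{C}$ be such that $(t,u)=(t_0,0)$ is the point with $u=0$ on the plane curve $C_{3,s_0}$ given by $$5u^2-2^2\cdot 5\, t - 2^{11}\cdot 3^{2}\, s_0^{4} - 2^{4}\cdot 5\, s_0 = 0 .$$ Then the sextic surface in $\mathbb{P}^3(\mathbb{C})$ defined by $f_{s_0,t_0,0}=0$ has exactly $35$ singularities of type $A_2$ and no other singularities.
   Context: Let $(x:y:z:w)$ be homogeneous coordinates on $\mathbb{P}^3=\mathbb{P}^3(\mathbb{C})$. Define $$p := z\cdot\prod_{j=0}^{4}\left[\cos\left(\tfrac{2\pi j}{5}\right)x+\sin\left(\tfrac{2\pi j}{5}\right)y-z\right] = \frac{z}{16}\Big[x\left(x^4-10x^2y^2+5y^4\right)-5z\left(x^2+y^2\right)^2+20z^3\left(x^2+y^2\right)-16z^5\Big].$$ For parameters $s,t,u\in\mathbb{C}$ put $$q_{s,t,u} := s(x^2+y^2)+t z^2+u\,zw+w^2,\qquad f_{s,t,u} := p-q_{s,t,u}^3,$$ a homogeneous polynomial of degree $6$ in $x,y,z,w$. A singular point of a surface is of type $A_k$ if, in suitable local analytic coordinates at that point, the surface is given by $x^{k+1}+y^2+z^2=0$. Singularities of type $A_2$ are also called cusps. *)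

(* Defs.v *)
From HB Require Import structures.
From mathcomp Require Import all_boot all_order all_algebra.
(* The notations of mpoly clash with those of analysis. *)
From mathcomp Require mpoly.
From mathcomp Require Import complex.
From mathcomp Require Import all_classical all_reals all_analysis.

Set Implicit Arguments.
Unset Strict Implicit.
Unset Printing Implicit Defensive.

Import Order.TTheory GRing.Theory Num.Theory.
Import numFieldNormedType.Exports.
Import -(notations) mpoly.

Local Open Scope classical_set_scope.
Local Open Scope ring_scope.
Local Open Scope complex_scope.

Definition projective_space (K : fieldType) (n : nat) :=
  {L : {vspace 'rV[K]_n.+1} | \dim L == 1%N}.

(* The chart x_i <> 0: insert the coordinate 1 at position i. *)
Definition affine_chart (K : fieldType) (n : nat) (i : 'I_n.+1)
    (a : 'rV[K]_n) : 'rV[K]_n.+1 :=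
  \row_j (if unlift i j is Some k then a ord0 k else 1).

Definition singular_at (K : fieldType) (n : nat) (F : mpoly n.+1 K)
    (P : projective_space K n) : Prop :=
  forall v : 'rV[K]_n.+1, v \in sval P -> v != 0 ->
    meval (v ord0) F = 0 /\
    forall i : 'I_n.+1, meval (v ord0) (mderiv i F) = 0.

(* Over K = C, complex differentiability on an open set is analyticity. *)
Definition holomorphic_on (K : numFieldType) (V W : normedModType K)
    (U : set V) (g : V -> W) : Prop :=
  open U /\ forall x, U x -> differentiable g x.

Definition biholomorphic_on (K : numFieldType) (V W : normedModType K)
    (U : set V) (phi : V -> W) : Prop :=
  holomorphic_on U phi /\
  exists psi : W -> V,
    holomorphic_on (phi @` U) psi /\ forall x, U x -> psi (phi x) = x.

(* The germ of {g = 0} at a is, in the local coordinates phi centred at a, the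
   germ of x^(k+1) + y^2 + z^2 = 0: the two equations agree up to the
   nowhere vanishing holomorphic factor e, i.e. they generate the same ideal. *)
Definition germ_type_A (K : numFieldType) (k : nat)
    (g : 'rV[K]_3 -> K) (a : 'rV[K]_3) : Prop :=
  exists (U : set 'rV[K]_3) (phi : 'rV[K]_3 -> 'rV[K]_3)
         (e : 'rV[K]_3 -> K^o),
  [/\ U a, phi a = 0, biholomorphic_on U phi, holomorphic_on U e &
      forall x, U x -> e x != 0 /\
        g x = e x * (phi x ord0 (inord 0) ^+ k.+1 +
                     phi x ord0 (inord 1) ^+ 2 + phi x ord0 (inord 2) ^+ 2)].

Definition type_A_at (K : numFieldType) (k : nat) (F : mpoly 4 K)
    (P : projective_space K 3) : Prop :=
  exists (i : 'I_4) (a : 'rV[K]_3),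
    affine_chart i a \in sval P /\
    germ_type_A k (fun b => meval (affine_chart i b ord0) F) a.

Definition hom_coord (K : fieldType) (i : nat) : mpoly 4 K :=
  mpolyX K (mnm1 (inord i : 'I_4)).

Definition pentagon_poly (R : realType) : mpoly 4 R[i] :=
  let x := hom_coord R[i] 0 in let y := hom_coord R[i] 1 in
  let z := hom_coord R[i] 2 in
  z * \prod_(j < 5) ((cos (2 * pi * j%:R / 5 : R))%:C *: x +
                     (sin (2 * pi * j%:R / 5 : R))%:C *: y - z).

Definition quadric_poly (K : fieldType) (s t u : K) : mpoly 4 K :=
  let x := hom_coord K 0 in let y := hom_coord K 1 in
  let z := hom_coord K 2 in let w := hom_coord K 3 in
  s *: (x ^+ 2 + y ^+ 2) + t *: z ^+ 2 + u *: (z * w) + w ^+ 2.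

Definition sextic_poly (R : realType) (s t u : R[i]) : mpoly 4 R[i] :=
  pentagon_poly R - quadric_poly s t u ^+ 3.

Definition curve_C3 (K : fieldType) (s t u : K) : Prop :=
  5 * u ^+ 2 - 2 ^+ 2 * 5 * t - 2 ^+ 11 * 3 ^+ 2 * s ^+ 4 - 2 ^+ 4 * 5 * s = 0.

(* Main.v *)
Require Import Defs.
From mathcomp Require Import all_boot all_order all_algebra.
From mathcomp Require mpoly.
From mathcomp Require Import complex.
From mathcomp Require Import all_classical all_reals all_analysis.
From mathcomp Require Import ring.

(** In the coordinates a = x + i y, b = x - i y the polynomial p depends only on
    z, ab and a^5 + b^5, so the sextic f is invariant under
    (a, b) -> (k a, k^-1 b) with k^5 = 1.  At a singular point with z <> 0,
    a f_a - b f_b = 0 forces a^5 = b^5, and a rotation brings the point to the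
    axis a = b = X; there f_w = 0 leaves either q = 0, and X^2 = 2X + 4 (nodes
    of the six lines), or w = 0 and X a double root of
    X^5 - 5 X^4 + 20 X^2 - 16 - 16 (s X^2 + t)^3.  With
    th = 9216 s^3 / 5 - 9 one has th^2 = -15, t = - s (17 + th) / 2, and the
    gcd of this polynomial and its derivative is (X - (7 - th) / 2)^2.  This
    root is triple, which gives one orbit of five cusps; the fifteen nodes of
    the line arrangement carry two cusps each.

    Local normal forms are produced one coordinate at a time: a simple root of
    a polynomial with holomorphic coefficients is a holomorphic function of the
    coefficients.  A nearby root exists because p' / p is the sum of the
    1 / (r - r_i), and it is differentiable by the identity
    P_v(r) - P_v(r') = (r - r') D_v(r, r'). *)

Set Implicit Arguments.
Unset Strict Implicit.
Unset Printing Implicit Defensive.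

Import Order.TTheory GRing.Theory Num.Theory.
Import numFieldNormedType.Exports.
Import -(notations) mpoly.
Local Open Scope classical_set_scope.
Local Open Scope ring_scope.

(** * Germs of holomorphic functions *)

(** The two kinds of cusp need two normal forms. At a point over a node, q = 0 and the sextic is c
    (A^2 + B^2) - q^3, where A^2 + B^2 is the product of the two lines through the node and c that
    of the others; q itself becomes a coordinate. This requires q_w = 2 w <> 0, that is, the conic s
    (x^2 + y^2) + t z^2 = 0 must miss the nodes. At the other five cusps q is nonzero; there
    evenness in y and w splits the sextic into the cube of X minus the triple root, y^2 and w^2,
    each times a unit. The equation for s is quadratic in s^3 with discriminant - 2^12 15^3, hence
    the square root th of -15; both signs are treated at once. As t / s lies in Q(th), s enters the
    equations on the axis only through s^3: identities there are checked modulo th^2 = -15, and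
    non-vanishing by norms. The 35 points are seven base points times five rotations: X = 1 +- sqrt
    5 with two values of w each, one cusp with w = 0, and two points over the node of z = 0 and x =
    z. *)

Section Holomorphic.
Variable K : numFieldType.

(** Differentiability depends only on the germ. The root branch constructed later is known through a
    formula valid near a point, not globally. *)
Lemma near_differentiable (V W : normedModType K) (f g : V -> W) (a : V) :
  (\forall x \near a, f x = g x) -> differentiable f a -> differentiable g a.
Proof.
move=> fg df.
have fga : f a = g a by apply: nbhs_singleton fg.
suff gE : g \o shift a = cst (g a) + 'd f a +o_ 0 id.
  have dc : continuous ('d f a) by apply: diff_continuous.
  by apply/diff_locallyP; rewrite (diff_unique dc gE).
have [_ /eqaddoP fE] := (diff_locallyP a f).1 df.
apply/eqaddoP => e e0; have := fE e e0.
have fg0 : \forall h \near (0 : V), f (h + a) = g (h + a).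
  by move: fg; rewrite (near_shift 0 a) subr0.
apply: filterS2 fg0 => h fgh.
by rewrite /= !fctE /= fgh fga.
Qed.

(** As [n] vanishes at [a], the derivative is q(a) times that of [n] and involves no derivative of
    [q]. In [root_branch] the factor [q] contains the very branch under study, known only to be
    continuous at that stage. *)
Lemma differentiableM_continuous (V : normedModType K) (n q : V -> K) (a : V) :
  n a = 0 -> differentiable n a -> {for a, continuous q} ->
  differentiable (fun x => n x * q x) a.
Proof.
move=> na dn cq.
have [dnc /eqaddoP nE] := (diff_locallyP a n).1 dn.
pose L : V -> K := q a \*: 'd n a.
have Lc : continuous L by move=> x; apply: cvgZl_tmp; apply: dnc.
suff gE : (fun x => n x * q x) \o shift a = cst (n a * q a) + L +o_ 0 id.
  by apply/diff_locallyP; rewrite (diff_unique Lc gE).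
apply/eqaddoP => e e0.
have [k k0 kP] := linear_lipschitz dnc.
have qb : \forall h \near (0 : V), `|q (h + a)| <= `|q a| + 1.
  have : \forall x \near a, `|q a - q x| < 1.
    by move/cvgrPdist_lt: cq; apply.
  rewrite (near_shift 0 a) subr0; apply: filterS => h /= /ltW h1.
  have -> : q (h + a) = q a - (q a - q (h + a)) by rewrite subKr.
  by apply: (le_trans (ler_normB _ _)); rewrite lerD2l.
have qs : \forall h \near (0 : V), `|q (h + a) - q a| <= e / 2 / k.
  have : \forall x \near a, `|q a - q x| < e / 2 / k.
    by move/cvgrPdist_lt: cq; apply; rewrite !divr_gt0.
  rewrite (near_shift 0 a) subr0; apply: filterS => h /= /ltW.
  by rewrite distrC.
have c0 : 0 < `|q a| + 1 by rewrite ltr_wpDl.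
have nE' : \forall h \near (0 : V),
    `|n (h + a) - 'd n a h| <= e / 2 / (`|q a| + 1) * `|h|.
  have := nE (e / 2 / (`|q a| + 1)) ltac:(by rewrite !divr_gt0).
  apply: filterS => h; rewrite -[X in `|X|]/(n (h + a) - (n a + 'd n a h)).
  by rewrite na add0r.
near=> h.
suff : `|n (h + a) * q (h + a) - (n a * q a + L h)| <= e * `|h| by [].
rewrite na mul0r add0r.
have -> : n (h + a) * q (h + a) - L h =
  (n (h + a) - 'd n a h) * q (h + a) + 'd n a h * (q (h + a) - q a).
  by rewrite -[L h]/(q a * 'd n a h); ring.
apply: (le_trans (ler_normD _ _)); rewrite !normrM [leRHS]splitr.
rewrite [e * _ / 2]mulrAC; apply: lerD; last first.
  apply: (@le_trans _ _ (k * `|h| * (e / 2 / k))).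
    by apply: ler_pM => //; near: h.
  by rewrite mulrC mulrA divfK ?gt_eqF.
apply: (@le_trans _ _ (e / 2 / (`|q a| + 1) * `|h| * (`|q a| + 1))).
  by apply: ler_pM => //; near: h.
rewrite [leLHS]mulrAC divfK ?gt_eqF //.
Unshelve. all: by end_near. Qed.

End Holomorphic.

(** Germ form of [holomorphic_on]: no open set is carried along, and finitely many such conditions
    are intersected as filters. *)
Definition hol (K : numFieldType) (V W : normedModType K) (a : V)
    (f : V -> W) : Prop :=
  \forall x \near a, differentiable f x.

Section HolomorphicGerms.
Variable K : numFieldType.
Implicit Types U V W : normedModType K.

Lemma hol_continuous V W (a : V) (f : V -> W) : hol a f -> {for a, continuous f}.
Proof. by move=> /nbhs_singleton; apply: differentiable_continuous. Qed.

Lemma hol_near V W (a : V) (f : V -> W) : hol a f -> \forall x \near a, hol x f.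
Proof. exact: near_join. Qed.

Lemma hol_cst V W (a : V) (b : W) : hol a (fun _ => b).
Proof. by apply: nearW => x; apply: differentiable_cst. Qed.

Lemma hol_id V (a : V) : hol a (fun x => x).
Proof. by apply: nearW => x; apply: ex_diff. Qed.

Lemma holD V W (a : V) (f g : V -> W) :
  hol a f -> hol a g -> hol a (fun x => f x + g x).
Proof. by apply: filterS2 => x; apply: differentiableD. Qed.

Lemma holN V W (a : V) (f : V -> W) : hol a f -> hol a (fun x => - f x).
Proof. by apply: filterS => x; apply: differentiableN. Qed.

Lemma holM V (a : V) (f g : V -> K) :
  hol a f -> hol a g -> hol a (fun x => f x * g x).
Proof. by apply: filterS2 => x; apply: differentiableM. Qed.

Lemma holX V (a : V) (f : V -> K) n : hol a f -> hol a (fun x => f x ^+ n).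
Proof.
move=> hf; elim: n => [|n IH]; first exact: hol_cst.
by under eq_fun do rewrite exprS; apply: holM.
Qed.

Lemma holV V (a : V) (f : V -> K) :
  hol a f -> f a != 0 -> hol a (fun x => (f x)^-1).
Proof.
move=> hf fa; have := hol_continuous hf => cf.
have fn0 : \forall x \near a, f x != 0 by exact: (cvgr_neq0 (f a) cf fa).
by apply: filterS2 hf fn0 => x; apply: differentiableV.
Qed.

Lemma hol_sum V W (a : V) n (f : 'I_n -> V -> W) :
  (forall i, hol a (f i)) -> hol a (fun x => \sum_(i < n) f i x).
Proof.
elim: n f => [|n IH] f hf.
  by under eq_fun do rewrite big_ord0; apply: hol_cst.
by under eq_fun do rewrite big_ord_recl; apply: holD => //; apply: IH.
Qed.

Lemma hol_comp U V W (a : U) (f : U -> V) (g : V -> W) :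
  hol a f -> hol (f a) g -> hol a (fun x => g (f x)).
Proof.
move=> hf hg; have cf := hol_continuous hf.
by apply: filterS2 hf (cf _ hg) => x; apply: differentiable_comp.
Qed.

Lemma hol_coord n (a : 'rV[K]_n) i : hol a (fun x : 'rV[K]_n => x ord0 i).
Proof.
by rewrite /hol; near=> x; apply: differentiable_coord.
Unshelve. all: by end_near. Qed.

Lemma hol_rV V n (a : V) (f : V -> 'rV[K]_n) :
  (forall j, hol a (fun x => f x ord0 j)) -> hol a f.
Proof.
move=> hf.
have -> : f = fun x => \sum_(j < n) f x ord0 j *: delta_mx ord0 j.
  by apply/funext => x; rewrite [LHS]row_sum_delta.
apply: hol_sum => j; apply: filterS (hf j) => x; apply: differentiableZl.
Qed.

End HolomorphicGerms.

(** * Holomorphic dependence of a simple root on the coefficients *)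

Section RootNear.
Variable K : numClosedFieldType.

Lemma poly_root_near (p : {poly K}) (a : K) : p^`().[a] != 0 ->
  exists2 r, root p r & `|r - a| * `|p^`().[a]| <= (size p)%:R * `|p.[a]|.
Proof.
move=> dpa.
have [pa|pa] := eqVneq p.[a] 0.
  by exists a; [apply/rootP | rewrite subrr normr0 mul0r pa normr0 mulr0].
have p0 : p != 0 by apply: contraNneq pa => ->; rewrite horner0.
have [s ps] := closed_field_poly_normal p.
have szp : size p = (size s).+1.
  by rewrite ps size_scale ?lead_coef_eq0 // size_prod_XsubC.
have logder (t : seq K) : (\prod_(z <- t) ('X - z%:P)).[a] != 0 ->
    (\prod_(z <- t) ('X - z%:P))^`().[a] =
    (\prod_(z <- t) ('X - z%:P)).[a] * \sum_(z <- t) (a - z)^-1.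
  elim: t => [|z t IH]; first by rewrite !big_nil derivC horner0 mulr0.
  rewrite !big_cons derivM derivXsubC mul1r !hornerE mulf_eq0 negb_or.
  by move=> /andP[az /IH ->]; field.
have [/hasP[z zs hz]|/hasPn far] :=
    boolP (has (fun z => `|z - a| * `|p^`().[a]| <= (size p)%:R * `|p.[a]|) s).
  by exists z => //; rewrite ps rootZ ?lead_coef_eq0 // root_prod_XsubC.
have : p^`().[a] = p.[a] * \sum_(z <- s) (a - z)^-1.
  have := pa; rewrite ps derivZ !hornerZ mulf_eq0 negb_or => /andP[_ h].
  by rewrite logder // mulrA.
(* If all roots were farther away, each of the [size s] terms, multiplied by |p(a)|, would be at
   most [C]. The bound counts [size p], one more than the number of roots, and this excess makes the
   final inequality strict. *)
move=> dE; suff : `|p^`().[a]| < `|p^`().[a]| by rewrite ltxx.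
rewrite {1}dE normrM; set C := `|p^`().[a]| / (size s).+1%:R.
have C0 : 0 < C by rewrite divr_gt0 ?normr_gt0 ?ltr0n.
have -> : `|p^`().[a]| = C *+ (size s).+1.
  by rewrite -mulr_natr divfK // pnatr_eq0.
apply: (@le_lt_trans _ _ (C *+ size s)); last by rewrite mulrSr ltrDl.
apply: le_trans (ler_wpM2l (normr_ge0 _) (ler_norm_sum _ _ _)) _.
have -> : C *+ size s = \sum_(z <- s) C.
  by rewrite big_const_seq iter_addr_0 count_predT.
rewrite mulr_sumr big_seq [leRHS]big_seq; apply: ler_sum => z zs.
have /= := far z zs; rewrite szp -real_ltNge ?realM ?ger0_real // => h.
have az : 0 < `|a - z|.
  rewrite normr_gt0; apply: contraTneq h => az.
  by rewrite distrC az normr0 mul0r lt_gtF // mulr_gt0 ?ltr0n ?normr_gt0.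
rewrite normfV ler_pdivrMr // /C mulrAC ler_pdivlMr ?ltr0n // mulrC.
by rewrite [leRHS]mulrC distrC ltW.
Qed.

Section RootBranch.
Variables (V : normedModType K) (n : nat) (c : nat -> V -> K) (a : V) (r0 : K).
Hypothesis hc : forall i, hol a (c i).

Let P (v : V) : {poly K} := \poly_(i < n) c i v.
(** The divided difference of [P v]. For i = 0 the inner sum is empty, so the truncation in [i.-1]
    is harmless. *)
Let D (v : V) (y z : K) : K :=
  \sum_(i < n) c i v * (\sum_(j < i) y ^+ (i.-1 - j) * z ^+ j).

Let diffD v y z : (P v).[y] - (P v).[z] = (y - z) * D v y z.
Proof.
rewrite !horner_poly -sumrB mulr_sumr; apply: eq_bigr => i _.
by rewrite -mulrBr subrXX mulrCA.
Qed.

Let diagD v y : D v y y = (P v)^`().[y].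
Proof.
rewrite /D /P poly_def (raddf_sum (@deriv K)) horner_sum; apply: eq_bigr => i _ /=.
rewrite derivZ derivXn hornerZ hornerMn hornerXn; congr (_ * _).
rewrite (eq_bigr (fun=> y ^+ i.-1)) ?sumr_const ?card_ord // => j _.
by rewrite -exprD subnK // -ltnS prednK // (leq_trans _ (ltn_ord j)).
Qed.

Let cvgD T (F : set_system T) (FF : Filter F) (v0 : V) (y0 z0 : K)
    (v : T -> V) (y z : T -> K) :
  (forall i, (i < n)%N -> {for v0, continuous (c i)}) ->
  v t @[t --> F] --> v0 -> y t @[t --> F] --> y0 -> z t @[t --> F] --> z0 ->
  D (v t) (y t) (z t) @[t --> F] --> D v0 y0 z0.
Proof.
move=> cc hv hy hz.
have cvg_X (f : T -> K) (l : K) k : f t @[t --> F] --> l ->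
    f t ^+ k @[t --> F] --> l ^+ k.
  move=> hf; elim: k => [|k IH]; first by under eq_fun do rewrite expr0; exact: cvg_cst.
  by under eq_fun do rewrite exprS; rewrite exprS; apply: cvgM.
have cvg_S m (f : 'I_m -> T -> K) (l : 'I_m -> K) :
    (forall i, f i t @[t --> F] --> l i) ->
    (\sum_(i < m) f i t) @[t --> F] --> \sum_(i < m) l i.
  by move=> hf; apply: cvg_big => // ; apply: add_continuous.
apply: (@cvg_S n (fun i t => c i (v t) * _) (fun i => c i v0 * _)) => i.
apply: cvgM; first by apply: cvg_comp hv _; apply: cc.
apply: (@cvg_S i (fun j t => y t ^+ _ * z t ^+ _) (fun j => y0 ^+ _ * z0 ^+ _)) => j.
by apply: cvgM; apply: cvg_X.
Qed.

Let hol_P v y : (forall i, (i < n)%N -> hol v (c i)) ->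
  hol v (fun v => (P v).[y]).
Proof.
move=> hcv; under eq_fun do rewrite horner_poly.
by apply: hol_sum => i; apply: holM; [exact: hcv | exact: hol_cst].
Qed.

(** One lower bound m < |D| near (a, r0, r0) yields everything: it makes the root of
    [poly_root_near] close to r0, two roots within [d] of r0 would force D = 0, and an increment of
    the root is a small value of P divided by D. *)
Lemma root_branch : root (P a) r0 -> (P a)^`().[r0] != 0 ->
  exists r : V -> K, [/\ r a = r0, hol a r, \forall v \near a, root (P v) (r v) &
    exists2 d : K, 0 < d &
      \forall v \near a, forall y, `|y - r0| < d -> root (P v) y -> y = r v].
Proof.
move=> /rootP P0; rewrite -diagD => D0.
have [m m0 mD] : exists2 m, 0 < m & m < `|D a r0 r0|.
  exists (`|D a r0 r0| / 2); first by rewrite divr_gt0 ?normr_gt0.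
  by rewrite ltr_pdivrMr // mulr_natr mulr2n ltrDl normr_gt0.
have [A nA [d d0 Dm]] : exists2 A, nbhs a A & exists2 d : K, 0 < d &
    forall v y z, A v -> `|y - r0| < d -> `|z - r0| < d -> m < `|D v y z|.
  have cc i : (i < n)%N -> {for a, continuous (c i)} by move=> _; apply: hol_continuous.
  have /(cvgr_norm_gt _) : D t.1 t.2.1 t.2.2 @[t --> (a, (r0, r0))] --> D a r0 r0.
    apply: cvgD => //; first exact: cvg_fst.
      by apply: cvg_comp; [exact: cvg_snd | exact: cvg_fst].
    by apply: cvg_comp; [exact: cvg_snd | exact: cvg_snd].
  move=> /(_ _ mD) [[A B] /= [nA [[B1 B2] /= [n1 n2] BB] AB]].
  have nB : nbhs r0 (B1 `&` B2) by exact: filterI.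
  move/nbhs_normP: nB => [d d0 dB].
  exists A => //; exists d => // v y z Av hy hz.
  apply: (AB (v, (y, z))); split => //; apply: BB; split => /=.
    by have [] := dB y ltac:(by rewrite /ball_ /= distrC).
  by have [] := dB z ltac:(by rewrite /ball_ /= distrC).
have exr : \forall v \near a, exists y, `|y - r0| < d /\ root (P v) y.
  have cP := hol_continuous (hol_P r0 (fun i _ => hc i)).
  have e0 : 0 < d * m / n.+1%:R by rewrite divr_gt0 ?mulr_gt0.
  move/cvgrPdist_lt: cP => /(_ _ e0); rewrite P0 => Psmall.
  near=> v.
  have Av : A v by near: v.
  have Dv : m < `|D v r0 r0| by apply: Dm => //; rewrite subrr normr0.
  have [|y yr yn] := @poly_root_near (P v) r0.
    by rewrite -diagD -normr_gt0 (lt_trans m0).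
  exists y; split=> //.
  rewrite -diagD in yn.
  rewrite -(ltr_pM2r (lt_trans m0 Dv)) (le_lt_trans yn) //.
  apply: (@le_lt_trans _ _ (n.+1%:R * `|(P v).[r0]|)).
    by rewrite ler_wpM2r // ler_nat (leq_trans (size_poly _ _)).
  apply: (@lt_trans _ _ (d * m)); last by rewrite ltr_pM2l.
  rewrite mulrC -ltr_pdivlMr ?ltr0n //.
  have : `|0 - (P v).[r0]| < d * m / n.+1%:R by near: v.
  by rewrite sub0r normrN.
(* [r0] is only the default where no root lies within [d]; near [a] there is one. *)
pose r v := xget r0 [set y | `|y - r0| < d /\ root (P v) y].
have rP : \forall v \near a, `|r v - r0| < d /\ root (P v) (r v).
  by apply: filterS exr => v exv; exact: (xgetPex r0 exv).
have uniq v y : A v -> `|y - r0| < d -> `|r v - r0| < d ->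
    root (P v) y -> root (P v) (r v) -> y = r v.
  move=> Av hy hr /rootP ry /rootP rr; apply/eqP; rewrite -subr_eq0.
  have /eqP := diffD v y (r v); rewrite ry rr subrr eq_sym mulf_eq0.
  case/orP => // /eqP DD; have := Dm _ _ _ Av hy hr.
  by rewrite DD normr0 lt_gtF.
exists r; split.
- have [hd hr] := nbhs_singleton rP.
  apply/esym/uniq => //; first exact: nbhs_singleton nA.
    by rewrite subrr normr0.
  exact/rootP.
- have nnA := near_join nA; have nnr := near_join rP.
  (* Only the coefficients below [n] are claimed to be holomorphic at all nearby points: infinitely
     many neighbourhoods need not contain a common one. *)
  have nnP : \forall v \near a, forall i, (i < n)%N -> hol v (c i).
    elim: n => [|k IH]; first exact: nearW.
    apply: filterS2 IH (hol_near (hc k)) => v IH hk i.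
    by rewrite ltnS leq_eqVlt => /orP[/eqP ->|/IH].
  rewrite /hol; apply: filterS3 nnA nnr nnP => v1 nA1 nr1 hc1.
  have A1 := nbhs_singleton nA1; have [rd1 /rootP rr1] := nbhs_singleton nr1.
  have dP1 := nbhs_singleton (hol_P (r v1) hc1).
  have cP1 := differentiable_continuous dP1.
  have rE : \forall v \near v1,
      r v1 + (P v).[r v1] * - (D v (r v) (r v1))^-1 = r v.
    apply: filterS2 nA1 nr1 => v Av [rd /rootP rr].
    have := diffD v (r v) (r v1); rewrite rr sub0r.
    have := Dm _ _ _ Av rd rd1; have [->|Dn0 _] := eqVneq (D v (r v) (r v1)) 0.
      by rewrite normr0 lt_gtF.
    move=> /eqP; rewrite eqr_oppLR => /eqP ->.
    by rewrite mulrN mulNr opprK mulfK // subrKC.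
  have cr1 : r v @[v --> v1] --> r v1.
    apply/cvgrPdist_lt => e e0.
    move/cvgrPdist_lt: cP1 => /(_ (e * m)); rewrite rr1 mulr_gt0 // => /(_ isT) h.
    apply: filterS3 nA1 nr1 (filterI rE h) => v Av [rd _] [<-].
    rewrite sub0r normrN => hP; rewrite opprD addNKr.
    have Dv := Dm _ _ _ Av rd rd1.
    rewrite mulrN opprK normrM normfV ltr_pdivrMr ?(lt_trans m0) //.
    by rewrite (lt_trans hP) // ltr_pM2l.
  apply: near_differentiable rE _; apply: differentiableD.
    exact: differentiable_cst.
  apply: differentiableM_continuous => //.
  apply: cvgN; apply: cvgV.
    by rewrite -normr_gt0 (lt_trans m0) // Dm.
  apply: cvgD => //; first by move=> i ?; apply: hol_continuous; apply: hc1.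
  exact: cvg_cst.
- by apply: filterS rP => v [].
- by exists d => //; apply: filterS2 nA rP => v Av [rd rr] y yd yr; apply: uniq.
Unshelve. all: by end_near. Qed.

End RootBranch.
End RootNear.

(** * Local biholomorphisms and A_k germs *)

Section LocalBiholomorphisms.
Variable K : numFieldType.

Definition loc_bihol (V W : normedModType K) (a : V) (b : W)
    (phi : V -> W) (psi : W -> V) : Prop :=
  [/\ hol a phi /\ hol b psi, phi a = b /\ psi b = a,
      \forall x \near a, psi (phi x) = x & \forall y \near b, phi (psi y) = y].

Lemma loc_bihol_comp (U V W : normedModType K) (a : U) (b : V) (c : W)
    phi psi phi' psi' :
  loc_bihol a b phi psi -> loc_bihol b c phi' psi' ->
  loc_bihol a c (fun x => phi' (phi x)) (fun y => psi (psi' y)).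
Proof.
move=> [[h1 h2] [ab ba] e1 e2] [[h1' h2'] [bc cb] e1' e2']; split.
- by split; apply: hol_comp; rewrite ?ab ?cb.
- by rewrite ab bc cb ba.
- have c1 := hol_continuous h1; rewrite -ab in e1'.
  by apply: filterS2 e1 (c1 _ e1') => x h /= ->.
- have c2 := hol_continuous h2'; rewrite -cb in e2.
  by apply: filterS2 e2' (c2 _ e2) => x h /= ->.
Qed.

Lemma loc_bihol_on (V W : normedModType K) (a : V) (b : W) phi psi (N : set V) :
  loc_bihol a b phi psi -> nbhs a N ->
  exists U, [/\ U a, U `<=` N & biholomorphic_on U phi].
Proof.
move=> [[h1 h2] [ab ba] e1 e2] nN.
have nA' := filterI nN (filterI h1 e1).
pose A := interior (N `&` ((fun x => differentiable phi x) `&`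
  (fun x => psi (phi x) = x))).
have nA : nbhs a A by apply: nbhs_interior; exact: nA'.
have oA : open A by exact: open_interior.
have Aa : A a by exact: nbhs_singleton nA.
have subA : A `<=` _ := @interior_subset _ _.
have nB' := filterI h2 e2.
pose B := interior ((fun y => differentiable psi y) `&`
  (fun y => phi (psi y) = y)).
have nB : nbhs b B by apply: nbhs_interior; exact: nB'.
have oB : open B by exact: open_interior.
have Bb : B b by exact: nbhs_singleton nB.
have subB : B `<=` _ := @interior_subset _ _.
have open_cap (S T : normedModType K) (C : set S) (D : set T) (f : S -> T) :
    open C -> open D -> (forall x, C x -> differentiable f x) ->
    open [set x | C x /\ D (f x)].
  move=> oC oD df; rewrite openE => x [Cx Dx].
  have cf := differentiable_continuous (df x Cx).
  by apply: filterI; [exact: open_nbhs_nbhs | apply: cf; exact: open_nbhs_nbhs].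
(* This choice is symmetric in [phi] and [psi]: the image of [U] is the corresponding set for [psi],
   hence open by continuity of [psi]. *)
pose U := [set x | A x /\ B (phi x)].
have imU : phi @` U = [set y | B y /\ A (psi y)].
  apply/seteqP; split => [_ [x [Ax Bx] <-]|y [By Ay]].
    by split => //; rewrite (subA _ Ax).2.2.
  exists (psi y); last exact: (subB _ By).2.
  by split => //; rewrite (subB _ By).2.
exists U; split; first by split; rewrite ?ab.
  by move=> x [/subA []].
split.
  split; first by apply: open_cap => // x /subA [_ []].
  by move=> x [/subA [_ []]].
exists psi; rewrite imU; split; last by move=> x [/subA [_ []]].
split; first by apply: open_cap => // x /subB [].
by move=> x [/subB []].
Qed.

Lemma bihol_on_loc (V W : normedModType K) (a : V) (U : set V) (phi : V -> W) :
  biholomorphic_on U phi -> U a -> exists psi, loc_bihol a (phi a) phi psi.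
Proof.
move=> [[oU h1] [psi [[oW h2] e]]] Ua; exists psi.
have nU : nbhs a U by exact: open_nbhs_nbhs.
have nW : nbhs (phi a) (phi @` U) by apply: open_nbhs_nbhs; split => //; exists a.
split.
- by split; [apply: filterS h1 nU | apply: filterS h2 nW].
- by split => //; apply: e.
- by apply: filterS e nU.
- by apply: filterS nW => _ [x Ux <-]; rewrite e.
Qed.

Definition A_form (k : nat) (v : 'rV[K]_3) : K :=
  v ord0 (inord 0) ^+ k.+1 + v ord0 (inord 1) ^+ 2 + v ord0 (inord 2) ^+ 2.

(** Trades the open sets of the definition for germs, in which coordinate changes compose freely. *)
Lemma germ_type_AP k (g : 'rV[K]_3 -> K) (a : 'rV[K]_3) :
  germ_type_A k g a <->
  exists (phi psi : 'rV[K]_3 -> 'rV[K]_3) (e : 'rV[K]_3 -> K), [/\ loc_bihol a 0 phi psi,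
    hol a e, e a != 0 & \forall x \near a, g x = e x * A_form k (phi x)].
Proof.
split=> [[U [phi [e [Ua phia bih [oU he] eq]]]]|[phi [psi [e [bih he ea eq]]]]].
  have [psi] := bihol_on_loc bih Ua; rewrite phia => loc.
  exists phi, psi, e; have nU : nbhs a U by exact: open_nbhs_nbhs.
  split=> //; [exact: filterS he nU | exact: (eq _ Ua).1|].
  by apply: filterS nU => x /eq[].
have ce := hol_continuous he.
have en0 : \forall x \near a, e x != 0 by exact: (cvgr_neq0 (e a) ce ea).
have [U [Ua sub bU]] := loc_bihol_on bih (filterI he (filterI en0 eq)).
exists U, phi, e; split => //; first by case: bih => _ [].
  by split; [case: bU => -[] | move=> x /sub[]].
by move=> x /sub[_ []].
Qed.

Lemma germ_type_A_pullback k (f g : 'rV[K]_3 -> K) (a b : 'rV[K]_3)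
    (phi psi : 'rV[K]_3 -> 'rV[K]_3) (e : 'rV[K]_3 -> K) :
  loc_bihol a b phi psi -> hol a e -> e a != 0 ->
  (\forall x \near a, f x = e x * g (phi x)) ->
  germ_type_A k g b -> germ_type_A k f a.
Proof.
move=> bih he ea fE /germ_type_AP [phi' [psi' [e' [bih' he' ea' gE]]]].
have [[h1 _] [ab _] _ _] := bih.
apply/germ_type_AP; exists (fun x => phi' (phi x)), (fun y => psi (psi' y)).
exists (fun x => e x * e' (phi x)); split.
- exact: loc_bihol_comp bih bih'.
- by apply: holM => //; apply: hol_comp; rewrite ?ab.
- by rewrite mulf_neq0 // ab.
- have c1 := hol_continuous h1; rewrite -ab in gE.
  by apply: filterS2 fE (c1 _ gE) => x -> /= ->; rewrite mulrA.
Qed.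

End LocalBiholomorphisms.

(** * Independence of the singularity type from the chart and from linear changes of coordinates *)

Section ProjectiveTransport.
Variable K : numFieldType.

(** The affine coordinates of a homogeneous vector in chart [j]; if its j-th coordinate is 0, all
    quotients are 0 by convention. *)
Definition dehom n (j : 'I_n.+1) (v : 'rV[K]_n.+1) : 'rV[K]_n :=
  \row_k (v ord0 (lift j k) / v ord0 j).

Lemma affine_chart_eq1 n (j : 'I_n.+1) (b : 'rV[K]_n) :
  affine_chart j b ord0 j = 1.
Proof. by rewrite mxE unlift_none. Qed.

Lemma affine_chart_lift n (j : 'I_n.+1) (b : 'rV[K]_n) k :
  affine_chart j b ord0 (lift j k) = b ord0 k.
Proof. by rewrite mxE liftK. Qed.

Lemma affine_chartK n (j : 'I_n.+1) : cancel (@affine_chart K n j) (dehom j).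
Proof.
move=> b; apply/rowP => k.
by rewrite mxE affine_chart_eq1 affine_chart_lift divr1.
Qed.

Lemma dehomK n (j : 'I_n.+1) (v : 'rV[K]_n.+1) : v ord0 j != 0 ->
  affine_chart j (dehom j v) = (v ord0 j)^-1 *: v.
Proof.
move=> vj; apply/rowP => k; rewrite mxE [RHS]mxE.
by case: unliftP => [m ->|->]; rewrite ?mxE ?mulVf // mulrC.
Qed.

Lemma dehomZ n (j : 'I_n.+1) (l : K) (v : 'rV[K]_n.+1) : l != 0 ->
  dehom j (l *: v) = dehom j v.
Proof. by move=> l0; apply/rowP => k; rewrite !mxE -mulf_div divff ?mul1r. Qed.

Lemma hol_affine_chart n (i : 'I_n.+1) (M : 'M[K]_n.+1) (a : 'rV[K]_n) m :
  hol a (fun x => (affine_chart i x *m M) ord0 m).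
Proof.
under eq_fun do rewrite mxE.
apply: hol_sum => k; apply: holM; last exact: hol_cst.
case: (unliftP i k) => [j ->|->].
  under eq_fun do rewrite affine_chart_lift; exact: hol_coord.
under eq_fun do rewrite affine_chart_eq1; exact: hol_cst.
Qed.

(** The inverse has the same shape, with [invmx M] and the charts exchanged, so [half] is proved
    once and used twice. *)
Lemma loc_bihol_chart n (i j : 'I_n.+1) (M : 'M[K]_n.+1) (a b : 'rV[K]_n) l :
  M \in unitmx -> l != 0 -> affine_chart i a *m M = l *: affine_chart j b ->
  loc_bihol a b (fun x => dehom j (affine_chart i x *m M))
    (fun y => dehom i (affine_chart j y *m invmx M)).
Proof.
have half i' j' (N : 'M[K]_n.+1) (a' b' : 'rV[K]_n) l' :
    N \in unitmx -> l' != 0 -> affine_chart i' a' *m N = l' *: affine_chart j' b' ->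
    [/\ hol a' (fun x => dehom j' (affine_chart i' x *m N)),
     dehom j' (affine_chart i' a' *m N) = b' &
     \forall x \near a', dehom i' (affine_chart j' (dehom j'
       (affine_chart i' x *m N)) *m invmx N) = x].
  move=> uN l0 eN.
  have d0 : (affine_chart i' a' *m N) ord0 j' != 0.
    by rewrite eN mxE affine_chart_eq1 mulr1.
  split.
  - apply: hol_rV => k; rewrite /dehom; under eq_fun do rewrite mxE.
    by apply: holM; [|apply: holV => //]; apply: hol_affine_chart.
  - by rewrite eN dehomZ // affine_chartK.
  - have := hol_continuous (@hol_affine_chart n i' N a' j') => cd.
    have : \forall x \near a', (affine_chart i' x *m N) ord0 j' != 0.
      exact: (cvgr_neq0 _ cd d0).
    apply: filterS => x dx; rewrite dehomK // -scalemxAl mulmxK //.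
    by rewrite dehomZ ?invr_eq0 // affine_chartK.
move=> uM l0 eM; have [h1 p1 e1] := half _ _ _ _ _ _ uM l0 eM.
have eM' : affine_chart j b *m invmx M = l^-1 *: affine_chart i a.
  by rewrite -[affine_chart i a](mulmxK uM) eM -scalemxAl scalerA mulVf // scale1r.
have [||h2 p2 e2] := half j i (invmx M) b a l^-1 _ _ eM'.
- by rewrite unitmx_inv.
- by rewrite invr_eq0.
by split => //; move: e2; rewrite invmxK.
Qed.

(** By homogeneity the two local equations differ by the d-th power of the j-th coordinate, which is
    a unit near [a]. *)
Lemma germ_type_A_transport k d (f1 f2 : 'rV[K]_4 -> K) (M : 'M[K]_4) i j a b l :
  M \in unitmx -> (forall v, f1 v = f2 (v *m M)) ->
  (forall c v, f2 (c *: v) = c ^+ d * f2 v) ->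
  l != 0 -> affine_chart i a *m M = l *: affine_chart j b ->
  germ_type_A k (fun y => f2 (affine_chart j y)) b ->
  germ_type_A k (fun x => f1 (affine_chart i x)) a.
Proof.
move=> uM fE hom l0 eM; have bih := loc_bihol_chart uM l0 eM.
have d0 : (affine_chart i a *m M) ord0 j != 0.
  by rewrite eM mxE affine_chart_eq1 mulr1.
have cd := hol_continuous (@hol_affine_chart 3 i M a j).
apply: (germ_type_A_pullback (e := fun x => (affine_chart i x *m M) ord0 j ^+ d) bih).
- by apply: holX; apply: hol_affine_chart.
- by rewrite expf_neq0.
- have : \forall x \near a, (affine_chart i x *m M) ord0 j != 0.
    exact: (cvgr_neq0 _ cd d0).
  apply: filterS => x dx; rewrite dehomK // hom exprVn mulrA divff ?mul1r //.
  by rewrite expf_neq0.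
Qed.

End ProjectiveTransport.

(** * Straightening one coordinate *)

Section CoordinateChange.
Variables (K : numFieldType) (n : nat).
Implicit Types (v x y : 'rV[K]_n) (j : 'I_n).

(** Independence of a function from the j-th variable is expressed below as invariance under
    [upd _ j]. *)
Definition upd v j (t : K) : 'rV[K]_n :=
  \row_k (if k == j then t else v ord0 k).

Lemma upd_same v j t : upd v j t ord0 j = t.
Proof. by rewrite mxE eqxx. Qed.

Lemma upd_other v j t k : k != j -> upd v j t ord0 k = v ord0 k.
Proof. by rewrite mxE => /negPf ->. Qed.

Lemma upd_upd v j t t' : upd (upd v j t) j t' = upd v j t'.
Proof. by apply/rowP => k; rewrite !mxE; case: eqP. Qed.

Lemma upd_id v j : upd v j (v ord0 j) = v.
Proof. by apply/rowP => k; rewrite !mxE; case: eqP => [->|]. Qed.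

Lemma hol_upd a j (f : 'rV[K]_n -> K) : hol a f -> hol a (fun v => upd v j (f v)).
Proof.
move=> hf; apply: hol_rV => k; have [->|kj] := eqVneq k j.
  by under eq_fun do rewrite upd_same.
by under eq_fun do rewrite upd_other //; exact: hol_coord.
Qed.

Lemma loc_bihol_upd a j t (f g : 'rV[K]_n -> K) :
  hol a f -> f a = t -> hol (upd a j t) g -> g (upd a j t) = a ord0 j ->
  (\forall v \near a, g (upd v j (f v)) = v ord0 j) ->
  (\forall v \near (upd a j t), f (upd v j (g v)) = v ord0 j) ->
  loc_bihol a (upd a j t) (fun v => upd v j (f v)) (fun v => upd v j (g v)).
Proof.
move=> hf fa hg ga gf fg; split; first by split; apply: hol_upd.
- by rewrite fa ga upd_upd upd_id.
- by apply: filterS gf => v; rewrite upd_upd => ->; rewrite upd_id.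
- by apply: filterS fg => v; rewrite upd_upd => ->; rewrite upd_id.
Qed.

End CoordinateChange.

Section Straightening.
Variable K : numClosedFieldType.

(** [root_branch] for X^(n+1) - z, whose root r0 is simple as r0 <> 0. The last clause, inversion of
    the power map on the other side, is the uniqueness of the branch. *)
Lemma nth_root_branch n (r0 : K) : r0 != 0 ->
  exists r : K -> K, [/\ hol (r0 ^+ n.+1) r, r (r0 ^+ n.+1) = r0,
    \forall z \near (r0 ^+ n.+1), r z ^+ n.+1 = z &
    \forall y \near r0, r (y ^+ n.+1) = y].
Proof.
move=> r0n.
pose c i (z : K) : K := if i == n.+1 then 1 else if i == 0%N then - z else 0.
have cE z : \poly_(i < n.+2) c i z = 'X^(n.+1) - z%:P.
  apply/polyP => i; rewrite coef_poly /c !coefE.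
  have [->|i1] := eqVneq i n.+1; first by rewrite ltnSn subr0.
  have [->|i0] := eqVneq i 0%N; first by rewrite sub0r.
  by rewrite subr0 if_same.
have hc i : hol (r0 ^+ n.+1) (c i).
  rewrite /c; case: (i == n.+1); first exact: hol_cst.
  by case: (i == 0%N); [apply: holN; apply: hol_id | exact: hol_cst].
have [||r [r1 r2 r3 [d d0 r4]]] := root_branch (n := n.+2) (r0 := r0) hc.
- by rewrite cE rootE !hornerE subrr.
- rewrite cE derivB derivXn derivC subr0 hornerMn hornerXn mulrn_eq0 /=.
  by rewrite expf_neq0.
exists r; split=> //.
  by apply: filterS r3 => z; rewrite cE rootE !hornerE subr_eq0 => /eqP.
have cX : {for r0, continuous (fun y : K => y ^+ n.+1)}.
  by apply: hol_continuous; apply: holX; apply: hol_id.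
have yd : \forall y \near r0, `|y - r0| < d.
  by apply/nbhs_normP; exists d => // y /=; rewrite distrC.
apply: filterS2 yd (cX _ r4) => y hy /(_ y hy) yE.
by apply/esym/yE; rewrite cE rootE !hornerE subrr.
Qed.

(** If t is the new coordinate, the old one is a square root of t / kap - Q, and a_j <> 0 selects a
    holomorphic branch of it. *)
Lemma straighten_square n (a : 'rV[K]_n) j (kap Q : 'rV[K]_n -> K) :
  hol a kap -> hol a Q -> (forall v t, kap (upd v j t) = kap v) ->
  (forall v t, Q (upd v j t) = Q v) -> kap a != 0 -> a ord0 j != 0 ->
  Q a + a ord0 j ^+ 2 = 0 ->
  exists psi, loc_bihol a (upd a j 0)
    (fun v => upd v j (kap v * (Q v + v ord0 j ^+ 2))) psi.
Proof.
move=> hk hQ ik iQ k0 a0 Q0.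
have [r [r1 r2 r3 r4]] := nth_root_branch 1 a0.
set b := upd a j 0.
have inv_near (f : 'rV[K]_n -> K) : hol a f -> (forall v t, f (upd v j t) = f v) ->
    hol b f.
  move=> hf fi.
  have -> : f = fun v => f (upd v j (a ord0 j)) by apply/funext => v; rewrite fi.
  apply: hol_comp; first by apply: hol_upd; apply: hol_cst.
  by rewrite /b upd_upd upd_id.
have hkb := inv_near _ hk ik; have hQb := inv_near _ hQ iQ.
pose w (v : 'rV[K]_n) := v ord0 j / kap v - Q v.
have wb : w b = a ord0 j ^+ 2.
  by rewrite /w upd_same mul0r sub0r iQ; apply/eqP; rewrite eqr_oppLR -addr_eq0 Q0.
have hw : hol b w.
  apply: holD; last exact: holN.
  by apply: holM; [exact: hol_coord | apply: holV; rewrite ?ik].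
exists (fun v => upd v j (r (w v))); apply: loc_bihol_upd.
- apply: holM => //; apply: holD => //; apply: holX; exact: hol_coord.
- by rewrite Q0 mulr0.
- by rewrite -/b; apply: (hol_comp hw); rewrite wb.
- by rewrite -/b wb.
- have ck := hol_continuous hk.
  have kn0 : \forall v \near a, kap v != 0 by apply: (cvgr_neq0 (kap a) ck k0).
  have cc := hol_continuous (@hol_coord _ n a j).
  apply: filterS2 kn0 (cc _ r4) => v kv /= rv; rewrite -[RHS]rv; congr r.
  by rewrite /w upd_same ik iQ [kap v * _]mulrC mulfK // addrC addKr.
- have ck := hol_continuous hkb.
  have kn0 : \forall v \near b, kap v != 0.
    by apply: (cvgr_neq0 (kap b) ck); rewrite ik.
  have cw := hol_continuous hw; rewrite -wb in r3.
  apply: filterS2 kn0 (cw _ r3) => v kv /= rv.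
  by rewrite upd_same ik iQ rv /w subrKC mulrC divfK.
Qed.

(** If t is the old coordinate, the new one is t times a square root of c0 + c1 t^2 + c2 t^4, which
    has a holomorphic branch because c0(a) <> 0. Three terms suffice for a sextic even in t. *)
Lemma straighten_even n (a : 'rV[K]_n) j (c0 c1 c2 : 'rV[K]_n -> K) :
  hol a c0 -> hol a c1 -> hol a c2 -> (forall v t, c0 (upd v j t) = c0 v) ->
  (forall v t, c1 (upd v j t) = c1 v) -> (forall v t, c2 (upd v j t) = c2 v) ->
  c0 a != 0 -> a ord0 j = 0 ->
  exists f psi, [/\ loc_bihol a a (fun v => upd v j (f v)) psi, f a = 0 &
    \forall v \near a, f v ^+ 2 = c0 v * v ord0 j ^+ 2 + c1 v * v ord0 j ^+ 4
                                  + c2 v * v ord0 j ^+ 6].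
Proof.
move=> h0 h1 h2 i0 i1 i2 c00 a0.
pose s0 := sqrtC (c0 a); have s00 : s0 != 0 by rewrite sqrtC_eq0.
have s0E : s0 ^+ 2 = c0 a by rewrite sqrtCK.
have [r [r1 r2 r3 r4]] := nth_root_branch 1 s00.
rewrite -/s0 s0E in r1 r2 r3.
have hj : hol a (fun v => v ord0 j) by exact: hol_coord.
pose p (v : 'rV[K]_n) := c0 v + c1 v * v ord0 j ^+ 2 + c2 v * v ord0 j ^+ 4.
have pa : p a = c0 a by rewrite /p a0 !expr0n /= !mulr0 !addr0.
have hp : hol a p.
  by apply: holD; [apply: holD => //|]; apply: holM => //; apply: holX.
pose h v := r (p v).
have ha : h a = s0 by rewrite /h pa.
have hh : hol a h by apply: hol_comp; rewrite ?pa.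
have hE : \forall v \near a, h v ^+ 2 = p v.
  by have cp := hol_continuous hp; rewrite -pa in r3; apply: cp _ r3.
(* k = 1/h, expressed through the new coordinate t = v_j h(v), is a root of
   c0 X^2 + c1 t^2 X^4 + c2 t^4 X^6 - 1. *)
pose c i (v : 'rV[K]_n) : K :=
  if i == 0%N then -1 else if i == 2 then c0 v else
  if i == 4 then c1 v * v ord0 j ^+ 2 else
  if i == 6 then c2 v * v ord0 j ^+ 4 else 0.
have hc i : hol a (c i).
  rewrite /c; case: (i == 0%N); first exact: hol_cst.
  case: (i == 2) => //; case: (i == 4); first by apply: holM => //; apply: holX.
  case: (i == 6); first by apply: holM => //; apply: holX.
  exact: hol_cst.
have cE v y : (\poly_(i < 7) c i v).[y] = -1 + c0 v * y ^+ 2 +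
    c1 v * v ord0 j ^+ 2 * y ^+ 4 + c2 v * v ord0 j ^+ 4 * y ^+ 6.
  by rewrite horner_poly !big_ord_recl big_ord0 /c /= /bump /=; ring.
have [||k [k1 k2 k3 [d d0 k4]]] := root_branch (n := 7) (r0 := s0^-1) hc.
- by rewrite rootE cE a0 expr0n /= exprVn s0E mulfV //; apply/eqP; ring.
- have -> : (\poly_(i < 7) c i a)^`() = (c0 a *+ 2) *: 'X.
    apply/polyP => i; rewrite coef_deriv coef_poly coefZ coefX /c a0.
    by case: i => [|[|[|[|[|[|[|i]]]]]]] //=; rewrite ?expr0n /= ?mulr0 ?mul0rn ?mulr1.
  by rewrite hornerZ hornerX mulf_neq0 ?invr_eq0 // mulrn_eq0.
exists (fun v : 'rV[K]_n => v ord0 j * h v), (fun v => upd v j (v ord0 j * k v)).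
have fa : a ord0 j * h a = 0 by rewrite a0 mul0r.
have ua : upd a j 0 = a by rewrite -[in LHS]a0 upd_id.
have ck := hol_continuous k2; have ch := hol_continuous hh.
split=> //.
  rewrite -[X in loc_bihol _ X]ua; apply: loc_bihol_upd; rewrite ?ua //.
  - by apply: holM.
  - by apply: holM.
  - by rewrite a0 mul0r.
  - have hV : hol a (fun v => (h v)^-1) by apply: holV; rewrite ?ha.
    have cV : (h v)^-1 @[v --> a] --> s0^-1.
      by rewrite -ha; apply: (hol_continuous hV).
    have hd : \forall v \near a, `|(h v)^-1 - s0^-1| < d.
      apply: (cV (fun y => `|y - s0^-1| < d)).
      by apply/nbhs_normP; exists d => // y /=; rewrite distrC.
    have hn0 : \forall v \near a, h v != 0.
      by apply: (cvgr_neq0 (h a) ch); rewrite ha.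
    have hu : hol a (fun v => upd v j (v ord0 j * h v)) by apply: hol_upd; apply: holM.
    have cu : upd v j (v ord0 j * h v) @[v --> a] --> a.
      by rewrite -[X in _ --> X]ua -fa; apply: (hol_continuous hu).
    (* At the new coordinate, 1/h is also a root and lies within [d] of [s0^-1]; uniqueness of the
       branch identifies it with [k]. *)
    apply: filterS3 (filterI hd hn0) hE (cu _ k4) => v [vd vn] vE /(_ _ vd) <-.
      by rewrite upd_same mulfK.
    rewrite rootE cE upd_same i0 i1 i2; apply/eqP.
    have -> : c0 v = h v ^+ 2 - c1 v * v ord0 j ^+ 2 - c2 v * v ord0 j ^+ 4.
      by rewrite vE /p; ring.
    by field.
  - have kn0 : \forall v \near a, k v != 0.
      by apply: (cvgr_neq0 (k a) ck); rewrite k1 invr_eq0.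
    have hV : hol a (fun v => (k v)^-1) by apply: holV; rewrite ?k1 ?invr_eq0.
    have cV : (k v)^-1 @[v --> a] --> s0.
      by rewrite -[s0]invrK -k1; apply: (hol_continuous hV).
    apply: filterS3 kn0 k3 (cV _ r4) => v kn kr /= rv.
    have pE : p (upd v j (v ord0 j * k v)) = (k v)^-1 ^+ 2.
      rewrite /p upd_same i0 i1 i2; apply/eqP; rewrite -subr_eq0.
      move/rootP: kr; rewrite cE => kr.
      have -> : c0 v + c1 v * (v ord0 j * k v) ^+ 2 + c2 v * (v ord0 j * k v) ^+ 4
        - (k v)^-1 ^+ 2 = (-1 + c0 v * k v ^+ 2 + c1 v * v ord0 j ^+ 2 * k v ^+ 4
           + c2 v * v ord0 j ^+ 4 * k v ^+ 6) / k v ^+ 2 by field.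
      by rewrite kr mul0r.
    by rewrite upd_same /h pE rv mulfK.
by apply: filterS hE => v vE; rewrite exprMn vE /p; ring.
Qed.

End Straightening.

(** * The two normal forms that produce A_2 germs *)

Section CuspGerms.
Variable K : numClosedFieldType.

Lemma inord3_neq i j : (i < 3)%N -> (j < 3)%N -> i != j ->
  (inord i : 'I_3) != inord j.
Proof. by move=> i3 j3; rewrite -val_eqE /= !inordK. Qed.

Lemma row3P (v w : 'rV[K]_3) :
  (forall i, (i < 3)%N -> v ord0 (inord i) = w ord0 (inord i)) -> v = w.
Proof. by move=> vw; apply/rowP => i; rewrite -(inord_val i) vw. Qed.

(** With kap^3 = -1/c, dividing by the unit c leaves v1^2 + v2^2 plus the cube of kap (Q + v0^2).
    This expression can replace v0 as a coordinate because its v0-derivative 2 kap v0 is nonzero at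
    [a]. *)
Lemma node_germ (g c Q : 'rV[K]_3 -> K) (a : 'rV[K]_3) :
  hol a c -> hol a Q -> (forall v t, c (upd v (inord 0) t) = c v) ->
  (forall v t, Q (upd v (inord 0) t) = Q v) -> c a != 0 ->
  a ord0 (inord 0) != 0 -> a ord0 (inord 1) = 0 -> a ord0 (inord 2) = 0 ->
  Q a + a ord0 (inord 0) ^+ 2 = 0 ->
  (forall v, g v = c v * (v ord0 (inord 1) ^+ 2 + v ord0 (inord 2) ^+ 2)
                   - (Q v + v ord0 (inord 0) ^+ 2) ^+ 3) ->
  germ_type_A 2 g a.
Proof.
move=> hc hQ ic iQ c0 a0 a1 a2 Qa gE.
have V0 : (c a)^-1 != 0 by rewrite invr_eq0.
pose r0 : K := 3.-root (c a)^-1.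
have r03 : r0 ^+ 3 = (c a)^-1 by rewrite rootCK.
have r00 : r0 != 0 by apply: contraNneq V0 => rz; rewrite -r03 rz expr0n.
have [r [r1 r2 r3 _]] := nth_root_branch 2 r00; rewrite r03 in r1 r2 r3.
pose kap v := - r (c v)^-1.
have hV : hol a (fun v => (c v)^-1) by exact: holV.
have hk : hol a kap by apply: holN; apply: hol_comp hV _.
have ik v t : kap (upd v (inord 0) t) = kap v by rewrite /kap ic.
have ka : kap a != 0 by rewrite /kap r2 oppr_eq0.
have [psi bih] := straighten_square hk hQ ik iQ ka a0 Qa.
have u0 : upd a (inord 0) 0 = 0.
  apply: row3P => -[|[|[|//]]] _; rewrite !mxE.
  - by rewrite eqxx.
  - by rewrite (negPf (inord3_neq _ _ _)).
  - by rewrite (negPf (inord3_neq _ _ _)).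
rewrite u0 in bih; apply/germ_type_AP; do 2 eexists; exists c.
split; [exact: bih|done..|].
have cV : (c v)^-1 @[v --> a] --> (c a)^-1 by apply: (hol_continuous hV).
have cc := hol_continuous hc.
have cn0 : \forall v \near a, c v != 0 by apply: (cvgr_neq0 (c a) cc).
apply: filterS2 cn0 (cV _ r3) => v cn /= rv.
rewrite /A_form upd_same !upd_other ?inord3_neq // gE !exprMn /kap.
by rewrite [(- r _) ^+ 3]exprNn rv; field.
Qed.

Lemma cusp_germ (g u : 'rV[K]_3 -> K) (al be : nat -> 'rV[K]_3 -> K)
    (xi : K) (a : 'rV[K]_3) :
  hol a u -> (forall i, hol a (al i)) -> (forall i, hol a (be i)) ->
  (forall v t, u (upd v (inord 1) t) = u v) ->
  (forall v t, u (upd v (inord 2) t) = u v) ->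
  (forall i v t, al i (upd v (inord 1) t) = al i v) ->
  (forall i v t, al i (upd v (inord 2) t) = al i v) ->
  (forall i v t, be i (upd v (inord 2) t) = be i v) ->
  u a != 0 -> al 0%N a != 0 -> be 0%N a != 0 ->
  a ord0 (inord 0) = xi -> a ord0 (inord 1) = 0 -> a ord0 (inord 2) = 0 ->
  (forall v, g v = (v ord0 (inord 0) - xi) ^+ 3 * u v +
    (al 0%N v * v ord0 (inord 1) ^+ 2 + al 1%N v * v ord0 (inord 1) ^+ 4 +
     al 2 v * v ord0 (inord 1) ^+ 6) +
    (be 0%N v * v ord0 (inord 2) ^+ 2 + be 1%N v * v ord0 (inord 2) ^+ 4 +
     be 2 v * v ord0 (inord 2) ^+ 6)) ->
  germ_type_A 2 g a.
Proof.
move=> hu hal hbe iu1 iu2 ial1 ial2 ibe u0 al0 be0 a0 a1 a2 gE.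
pose A i v := al i v / u v; pose B i v := be i v / u v.
have hV : hol a (fun v => (u v)^-1) by exact: holV.
have hA i : hol a (A i) by exact: holM.
have hB i : hol a (B i) by exact: holM.
have [||||f1 [psi1 [bih1 f1a f1E]]] :=
  straighten_even (j := inord 1) (hA 0%N) (hA 1%N) (hA 2) _ _ _ _ a1.
1-3: by move=> v t; rewrite /A ial1 iu1.
  by rewrite mulf_neq0 ?invr_eq0.
have [||||f2 [psi2 [bih2 f2a f2E]]] :=
  straighten_even (j := inord 2) (hB 0%N) (hB 1%N) (hB 2) _ _ _ _ a2.
1-3: by move=> v t; rewrite /B ibe iu2.
  by rewrite mulf_neq0 ?invr_eq0.
pose phi0 (v : 'rV[K]_3) := upd v (inord 0) (v ord0 (inord 0) - xi).
pose psi0 (v : 'rV[K]_3) := upd v (inord 0) (v ord0 (inord 0) + xi).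
have u00 : upd a (inord 0) 0 = 0.
  apply: row3P => -[|[|[|//]]] _; rewrite !mxE.
  - by rewrite eqxx.
  - by rewrite (negPf (inord3_neq _ _ _)).
  - by rewrite (negPf (inord3_neq _ _ _)).
have bih0 : loc_bihol a 0 phi0 psi0.
  rewrite -u00; apply: loc_bihol_upd.
  - by apply: holD; [exact: hol_coord | exact: hol_cst].
  - by rewrite a0 subrr.
  - by apply: holD; [exact: hol_coord | exact: hol_cst].
  - by rewrite upd_same a0 add0r.
  - by near=> v; rewrite upd_same subrK.
  - by near=> v; rewrite upd_same addrK.
(* [be] may involve coordinate 1, so coordinate 2 is straightened first, while coordinate 1 still
   has its old value; [al] and [u] are unaffected by that change. *)
have bih := loc_bihol_comp (loc_bihol_comp bih2 bih1) bih0.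
apply/germ_type_AP; do 2 eexists; exists u; split; [exact: bih|done..|].
have [[h2 _] [p2 _] _ _] := bih2.
have cu := hol_continuous hu.
have un0 : \forall v \near a, u v != 0 by apply: (cvgr_neq0 (u a) cu).
have c2 : upd v (inord 2) (f2 v) @[v --> a] --> a.
  by rewrite -[X in _ --> X]p2; apply: (hol_continuous h2).
apply: filterS3 un0 f2E (c2 _ f1E) => v un f2v /= f1v.
rewrite /A_form /phi0 upd_same !(@upd_other _ _ _ (inord 0)) ?inord3_neq //.
rewrite upd_same !(@upd_other _ _ _ (inord 1)) ?inord3_neq // upd_same.
rewrite !(@upd_other _ _ _ (inord 2)) ?inord3_neq // f1v f2v /A /B !ial2 !iu2.
rewrite !upd_other ?inord3_neq // gE.
by field.
Unshelve. all: by end_near. Qed.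

End CuspGerms.

(** * The sextic in the coordinates (a, b, z, w) *)

Section SexticAlgebra.
Variable K : numFieldType.
Implicit Types s t a b z w X th : K.

(** For a = x + i y and b = x - i y one has ab = x^2 + y^2 and (a^5 + b^5) / 2 = x (x^4 - 10 x^2 y^2
    + 5 y^4). *)
Definition sext s t a b z w : K :=
  z / 16 * ((a ^+ 5 + b ^+ 5) / 2 - 5 * z * (a * b) ^+ 2 + 20 * z ^+ 3 * (a * b)
            - 16 * z ^+ 5) - (s * (a * b) + t * z ^+ 2 + w ^+ 2) ^+ 3.

(* The partial derivative in b is sext_da with a and b exchanged. *)
Definition sext_da s t a b z w : K :=
  z / 16 * (5 / 2 * a ^+ 4 - 10 * z * (a * b ^+ 2) + 20 * z ^+ 3 * b)
  - 3 * s * b * (s * (a * b) + t * z ^+ 2 + w ^+ 2) ^+ 2.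

Definition sext_dz s t a b z w : K :=
  ((a ^+ 5 + b ^+ 5) / 2 - 10 * z * (a * b) ^+ 2 + 80 * z ^+ 3 * (a * b)
   - 96 * z ^+ 5) / 16 - 6 * t * z * (s * (a * b) + t * z ^+ 2 + w ^+ 2) ^+ 2.

Definition sext_dw s t a b z w : K :=
  - (6 * w * (s * (a * b) + t * z ^+ 2 + w ^+ 2) ^+ 2).

Definition sing s t a b z w : Prop :=
  [/\ sext s t a b z w = 0, sext_da s t a b z w = 0, sext_da s t b a z w = 0,
      sext_dz s t a b z w = 0 & sext_dw s t a b z w = 0].

Lemma sextZ s t l a b z w :
  sext s t (l * a) (l * b) (l * z) (l * w) = l ^+ 6 * sext s t a b z w.
Proof. by rewrite /sext; field. Qed.

Lemma singZ s t l a b z w :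
  sing s t a b z w -> sing s t (l * a) (l * b) (l * z) (l * w).
Proof.
have daZ x y : sext_da s t (l * x) (l * y) (l * z) (l * w) =
    l ^+ 5 * sext_da s t x y z w by rewrite /sext_da; field.
have dzZ x y : sext_dz s t (l * x) (l * y) (l * z) (l * w) =
    l ^+ 5 * sext_dz s t x y z w by rewrite /sext_dz; field.
have dwZ x y : sext_dw s t (l * x) (l * y) (l * z) (l * w) =
    l ^+ 5 * sext_dw s t x y z w by rewrite /sext_dw; ring.
by move=> [f0 a0 b0 z0 w0]; split;
  rewrite ?sextZ ?daZ ?dzZ ?dwZ ?f0 ?a0 ?b0 ?z0 ?w0 mulr0.
Qed.

Lemma sext_rot s t k k' a b z w : k ^+ 5 = 1 -> k * k' = 1 ->
  sext s t (k * a) (k' * b) z w = sext s t a b z w.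
Proof.
move=> k5 kk; have k5' : k' ^+ 5 = 1 by rewrite -[LHS]mul1r -k5 -exprMn kk expr1n.
have ab : k * a * (k' * b) = a * b by rewrite mulrACA kk mul1r.
have aE : (k * a) ^+ 5 = a ^+ 5 by rewrite exprMn k5 mul1r.
have bE : (k' * b) ^+ 5 = b ^+ 5 by rewrite exprMn k5' mul1r.
by rewrite /sext ab aE bE.
Qed.

Lemma sing_rot s t k k' a b z w : k ^+ 5 = 1 -> k * k' = 1 ->
  sing s t a b z w -> sing s t (k * a) (k' * b) z w.
Proof.
move=> k5 kk; have k5' : k' ^+ 5 = 1 by rewrite -[LHS]mul1r -k5 -exprMn kk expr1n.
have ab : k * a * (k' * b) = a * b by rewrite mulrACA kk mul1r.
have da x x' a' b' : x ^+ 5 = 1 -> x * x' = 1 ->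
    sext_da s t (x * a') (x' * b') z w = x' * sext_da s t a' b' z w.
  move=> x5 xx; have x4 : x ^+ 4 = x'.
    by rewrite -[RHS]mul1r -x5 [x ^+ 5]exprSr -mulrA xx mulr1.
  have ab' : x * a' * (x' * b') = a' * b' by rewrite mulrACA xx mul1r.
  rewrite /sext_da ab' (exprMn 4) x4 (exprMn 2).
  have -> : x * a' * (x' ^+ 2 * b' ^+ 2) = x * x' * x' * (a' * b' ^+ 2) by ring.
  by rewrite xx; field.
have dz : sext_dz s t (k * a) (k' * b) z w = sext_dz s t a b z w.
  have aE : (k * a) ^+ 5 = a ^+ 5 by rewrite exprMn k5 mul1r.
  have bE : (k' * b) ^+ 5 = b ^+ 5 by rewrite exprMn k5' mul1r.
  by rewrite /sext_dz ab aE bE.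
have dw : sext_dw s t (k * a) (k' * b) z w = sext_dw s t a b z w.
  by rewrite /sext_dw ab.
have db : sext_da s t (k' * b) (k * a) z w = k * sext_da s t b a z w.
  by apply: da; rewrite // mulrC.
move=> [f0 a0 b0 z0 w0].
by split; rewrite ?sext_rot ?db ?(da _ _ _ _ k5 kk) ?dz ?dw ?f0 ?a0 ?b0 ?mulr0.
Qed.

(** On z = 0 the sextic is - q^3, so q = 0 and f_z reduces to (a^5 + b^5) / 32: these are points
    over the nodes on the line z = 0. *)
Lemma sing_cases s t a b z w : sing s t a b z w ->
  [|| a != 0, b != 0, z != 0 | w != 0] ->
  [/\ z = 0, b != 0, a ^+ 5 = - b ^+ 5 & w ^+ 2 = - (s * (a * b))] \/
  [/\ z != 0 & a ^+ 5 = b ^+ 5].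
Proof.
move=> [f0 a0 b0 z0 w0] nz; have [zz|zn] := eqVneq z 0; [left|right].
  move: f0 z0; rewrite /sext /sext_dz zz.
  have -> : 0 / 16 * ((a ^+ 5 + b ^+ 5) / 2 - 5 * 0 * (a * b) ^+ 2 +
    20 * 0 ^+ 3 * (a * b) - 16 * 0 ^+ 5) - (s * (a * b) + t * 0 ^+ 2 + w ^+ 2) ^+ 3
    = - (s * (a * b) + w ^+ 2) ^+ 3 by field.
  have -> : ((a ^+ 5 + b ^+ 5) / 2 - 10 * 0 * (a * b) ^+ 2 + 80 * 0 ^+ 3 * (a * b)
   - 96 * 0 ^+ 5) / 16 - 6 * t * 0 * (s * (a * b) + t * 0 ^+ 2 + w ^+ 2) ^+ 2
    = (a ^+ 5 + b ^+ 5) / 32 by field.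
  move=> /eqP; rewrite oppr_eq0 expf_eq0 /= addrC addr_eq0 => /eqP w2.
  move=> /eqP; rewrite mulf_eq0 invr_eq0 pnatr_eq0 orbF addr_eq0 => /eqP ab.
  split=> //; apply: contraTneq nz => b00; move: ab w2.
  rewrite b00 expr0n oppr0 => /eqP; rewrite expf_eq0 /= => /eqP ->.
  by rewrite !mulr0 oppr0 => /eqP; rewrite expf_eq0 /= => /eqP ->; rewrite zz !eqxx.
split=> //.
have : 5 / 32 * z * (a ^+ 5 - b ^+ 5) =
    a * sext_da s t a b z w - b * sext_da s t b a z w by rewrite /sext_da; field.
rewrite a0 b0 !mulr0 subrr => /eqP; rewrite !mulf_eq0 (negPf zn) invr_eq0.
by rewrite !pnatr_eq0 /= subr_eq0 => /eqP.
Qed.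

Section SpecialValues.
Variables (s t th : K).
Hypotheses (s3E : s ^+ 3 = 5 * (9 + th) / 9216) (th2 : th ^+ 2 = -15)
           (tE : t = - s * (17 + th) / 2).

Lemma sext_axis X w : sext s t X X 1 w =
  (X ^+ 5 - 5 * X ^+ 4 + 20 * X ^+ 2 - 16) / 16 - (s * X ^+ 2 + t + w ^+ 2) ^+ 3.
Proof. by rewrite /sext; field. Qed.

(** By the symmetry in a and b this is half the X-derivative of [sext_axis]. *)
Lemma sext_da_axis X w : sext_da s t X X 1 w =
  X * (5 * X ^+ 3 - 20 * X ^+ 2 + 40) / 32 - 3 * s * X * (s * X ^+ 2 + t + w ^+ 2) ^+ 2.
Proof. by rewrite /sext_da; field. Qed.

Definition cusp_abs : K := (7 - th) / 2.

(** The conic is s times a polynomial over Q(th), so its cube involves s only through s^3. Together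
    with [conic_sqr] this removes s and t from the identities on the axis. *)
Lemma conic_cube Y : (s * Y + t) ^+ 3 = 5 * (9 + th) / 9216 * (Y - (17 + th) / 2) ^+ 3.
Proof. by rewrite -s3E tE; field. Qed.

Lemma conic_sqr Y :
  s * (s * Y + t) ^+ 2 = 5 * (9 + th) / 9216 * (Y - (17 + th) / 2) ^+ 2.
Proof. by rewrite -s3E tE; field. Qed.


Lemma sing_axis X w : sing s t X X 1 w ->
  X ^+ 2 = 2 * X + 4 /\ w ^+ 2 = - (s * X ^+ 2 + t) \/ X = cusp_abs /\ w = 0.
Proof.
move=> [f0 a0 _ _ w0]; move: f0 a0 w0; rewrite sext_axis sext_da_axis => f0 a0.
have [w0 _|wn] := eqVneq w 0; last first.
  move=> /eqP; rewrite /sext_dw oppr_eq0 mulf_eq0 expf_eq0 mulf_eq0 pnatr_eq0 (negPf wn).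
  rewrite expr1n mulr1 -expr2 /= => /eqP q0; left; split; last first.
    by apply/eqP; rewrite -addr_eq0 addrC q0.
  move: f0 a0; rewrite q0 !expr0n /= mulr0 !subr0 => /eqP.
  rewrite mulf_eq0 invr_eq0 pnatr_eq0 orbF => /eqP p0 /eqP.
  rewrite !mulf_eq0 invr_eq0 pnatr_eq0 orbF.
  have [X0|X0 /= /eqP d0] := eqVneq X 0.
    move: p0; rewrite X0 !expr0n /= !mulr0 subr0 !add0r => /eqP.
    by rewrite oppr_eq0 pnatr_eq0.
  (* On the axis 16 p = (X - 1) (X^2 - 2 X - 4)^2. The derivative has the additional zeros 0 and 2,
     where 16 p is -16 and 16. *)
  have : (X - 2) * (X ^+ 2 - 2 * X - 4) = (5 * X ^+ 3 - 20 * X ^+ 2 + 40) / 5.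
    by field.
  rewrite d0 mul0r => /eqP; rewrite mulf_eq0 subr_eq0 => /orP[/eqP X2|/eqP Y0].
    have /eqP : 16 = 0 :> K by rewrite -[RHS]p0 X2; ring.
    by rewrite pnatr_eq0.
  by rewrite -[LHS]subr0 -Y0; ring.
right; split=> //; move: f0 a0; rewrite w0 expr0n addr0 => f0 a0.
suff /eqP : (X - cusp_abs) ^+ 2 = 0 by rewrite expf_eq0 subr_eq0 => /eqP.
(* Bezout relation between the restriction to the axis and its derivative. *)
transitivity ((((- (3 ^+ 2 * 437) / (2 ^+ 7 * 136)) + (- (3 * 329) / (2 ^+ 7 * 136)) * th) +
    (((3 ^+ 3 * 195) / (2 ^+ 10 * 136)) + ((9 * 1000 + 607) / (2 ^+ 10 * 136)) * th) * X +
    ((- (3 ^+ 3 * 467) / (2 ^+ 11 * 136)) + (- 4439 / (2 ^+ 11 * 136)) * th) * X ^+ 2) * 16 *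
  ((X ^+ 5 - 5 * X ^+ 4 + 20 * X ^+ 2 - 16) / 16 - (s * X ^+ 2 + t) ^+ 3) +
  (((33 / (2 * 160)) + (37 / (2 ^+ 3 * 120)) * th) +
    (((3 * 1363) / (2 ^+ 11 * 170)) + ((28 * 1000 + 573) / (2 ^+ 12 * 3 * 85)) * th) * X +
    ((- (19 * 1000 + 393) / (2 ^+ 12 * 170)) + (- (30 * 1000 + 853) / (2 ^+ 13 * 3 * 85)) * th) * X ^+ 2 +
    (((3 ^+ 2 * 467) / (2 ^+ 12 * 136)) + (4439 / (2 ^+ 14 * 102)) * th) * X ^+ 3) * 32 *
  (X * (5 * X ^+ 3 - 20 * X ^+ 2 + 40) / 32 - 3 * s * X * (s * X ^+ 2 + t) ^+ 2)).
  have -> : 3 * s * X * (s * X ^+ 2 + t) ^+ 2 = 3 * X * (s * (s * X ^+ 2 + t) ^+ 2).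
    by ring.
  by rewrite conic_cube conic_sqr /cusp_abs; field: th2.
by rewrite f0 a0 !mulr0 addr0.
Qed.

Lemma sing_node X w : X ^+ 2 = 2 * X + 4 -> w ^+ 2 = - (s * X ^+ 2 + t) ->
  sing s t X X 1 w.
Proof.
move=> X2 w2.
have q0 : s * (X * X) + t * 1 ^+ 2 + w ^+ 2 = 0.
  by rewrite w2 expr1n mulr1 -expr2 subrr.
have [X3 X4 X5] : [/\ X ^+ 3 = 8 * X + 8, X ^+ 4 = 24 * X + 32 & X ^+ 5 = 80 * X + 96].
  by split; ring: X2.
by split; rewrite /sext /sext_da /sext_dz /sext_dw q0 ?expr0n /= ?mulr0 ?subr0 ?oppr0 //;
  field: X2.
Qed.

Lemma sing_cusp : sing s t cusp_abs cusp_abs 1 0.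
Proof.
have da : sext_da s t cusp_abs cusp_abs 1 0 = 0.
  rewrite sext_da_axis expr0n addr0.
  have -> : 3 * s * cusp_abs * (s * cusp_abs ^+ 2 + t) ^+ 2 =
    3 * cusp_abs * (s * (s * cusp_abs ^+ 2 + t) ^+ 2) by ring.
  by rewrite conic_sqr /cusp_abs; field: th2.
split=> //.
- by rewrite sext_axis expr0n addr0 conic_cube /cusp_abs; field: th2.
- rewrite /sext_dz expr0n !expr1n /= addr0 !mulr1 -expr2.
  have -> : 6 * t * (s * cusp_abs ^+ 2 + t) ^+ 2 =
     - 3 * (17 + th) * (s * (s * cusp_abs ^+ 2 + t) ^+ 2) by rewrite {1}tE; field.
  by rewrite conic_sqr /cusp_abs; field: th2.
- by rewrite /sext_dw mulr0 mul0r oppr0.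
Qed.

Lemma sing_infinity i w : i ^+ 2 = -1 -> w ^+ 2 = - s -> sing s t i (- i) 0 w.
Proof.
move=> i2 w2.
have q0 : s * (i * (- i)) + t * 0 ^+ 2 + w ^+ 2 = 0.
  by rewrite mulrN -expr2 i2 opprK mulr1 expr0n mulr0 addr0 w2 subrr.
by split; rewrite /sext /sext_da /sext_dz /sext_dw ?[- i * i]mulrC q0; field.
Qed.

End SpecialValues.
End SexticAlgebra.

(** * Cusps at the base points *)

Section Coordinates.
Variable K : numClosedFieldType.
Implicit Types (v w : 'rV[K]_4).

Definition row4 (a b c d : K) : 'rV[K]_4 := \row_j nth 0 [:: a; b; c; d] j.

Definition mx4 (r : seq (seq K)) : 'M[K]_4 :=
  \matrix_(i, j) nth 0 (nth [::] r i) j.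

Lemma row4E a b c d k : (k < 4)%N ->
  row4 a b c d ord0 (inord k) = nth 0 [:: a; b; c; d] k.
Proof. by move=> k4; rewrite mxE inordK. Qed.

Lemma row4P v w :
  (forall i, (i < 4)%N -> v ord0 (inord i) = w ord0 (inord i)) -> v = w.
Proof. by move=> vw; apply/rowP => i; rewrite -(inord_val i) vw. Qed.

Lemma mul_mx4 v r k : (k < 4)%N -> (v *m mx4 r) ord0 (inord k) =
  v ord0 (inord 0) * nth 0 (nth [::] r 0) k + v ord0 (inord 1) * nth 0 (nth [::] r 1) k
  + v ord0 (inord 2) * nth 0 (nth [::] r 2) k + v ord0 (inord 3) * nth 0 (nth [::] r 3) k.
Proof.
move=> k4; rewrite mxE.
have sum4 (F : 'I_4 -> K) :
    \sum_i F i = F (inord 0) + F (inord 1) + F (inord 2) + F (inord 3).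
  rewrite !big_ord_recl big_ord0 addr0 !addrA.
  by congr (F _ + F _ + F _ + F _); apply: val_inj; rewrite /= inordK.
by rewrite sum4 !mxE !inordK.
Qed.

Lemma unitmx_left_inv (M N : 'M[K]_4) :
  (forall v, v *m M *m N = v) -> M \in unitmx.
Proof.
move=> vMN; suff /mulmx1_unit[] : M *m N = 1%:M by [].
by apply/row_matrixP => i; rewrite !rowE mulmxA vMN mulmx1.
Qed.

Lemma chart3E (b : 'rV[K]_3) k : (k < 3)%N ->
  affine_chart (inord 3 : 'I_4) b ord0 (inord k) = b ord0 (inord k).
Proof.
move=> k3.
have -> : inord k = lift (inord 3) (inord k : 'I_3) :> 'I_4.
  have k4 : (k < 4)%N by exact: ltn_trans k3 _.
  apply: val_inj => /=; rewrite /bump !inordK //. by rewrite leqNgt k3.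
exact: affine_chart_lift.
Qed.

Definition sexF s t v := sext s t (v ord0 (inord 0) + 'i * v ord0 (inord 1))
  (v ord0 (inord 0) - 'i * v ord0 (inord 1)) (v ord0 (inord 2)) (v ord0 (inord 3)).

(** [type_A_at] for the point spanned by a vector, with [sexF] in place of the evaluated polynomial;
    [l] is nonzero because a chart vector has a coordinate 1. *)
Definition type_A2_vec s t v := exists i a,
  (exists l : K, affine_chart i a = l *: v) /\
  germ_type_A 2 (fun b => sexF s t (affine_chart i b)) a.

Lemma sexFZ s t l v : sexF s t (l *: v) = l ^+ 6 * sexF s t v.
Proof. by rewrite /sexF -sextZ !mxE; congr sext; ring. Qed.

Lemma row_neq0 n (v : 'rV[K]_n) : v != 0 -> exists i, v ord0 i != 0.
Proof.
move=> v0; apply/existsP; apply: contraNT v0; rewrite negb_exists => /forallP h.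
by apply/eqP/rowP => i; rewrite mxE; apply/eqP; have := h i; rewrite negbK.
Qed.

(** [N] adapts the coordinates to a base point, with a nonvanishing homogeneous coordinate put last,
    and [R] is a symmetry; one germ computation thus serves a whole orbit. *)
Lemma type_A2_transport s t (N R : 'M[K]_4) (b : 'rV[K]_3) :
  N \in unitmx -> R \in unitmx -> (forall v, sexF s t (v *m R) = sexF s t v) ->
  germ_type_A 2 (fun y => sexF s t (affine_chart (inord 3) y *m N)) b ->
  type_A2_vec s t (affine_chart (inord 3) b *m N *m R).
Proof.
move=> uN uR inv germ; set u := affine_chart (inord 3) b; set v := u *m N *m R.
have uNR : N *m R \in unitmx by rewrite unitmx_mul uN.
have v0 : v != 0.
  apply/eqP => v0; have : u = 0.
    by rewrite -[u](mulmxK uNR) mulmxA -/v v0 mul0mx.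
  move/(congr1 (fun x : 'rV[K]_4 => x ord0 (inord 3))).
  by rewrite affine_chart_eq1 mxE => /eqP; rewrite oner_eq0.
have [i vi] := row_neq0 v0; exists i, (dehom i v); split.
  by exists (v ord0 i)^-1; rewrite dehomK.
apply: (@germ_type_A_transport _ 2 6 (sexF s t) (fun v => sexF s t (v *m N))
  (invmx (N *m R)) i (inord 3) _ b (v ord0 i)^-1).
- by rewrite unitmx_inv.
- by move=> x; rewrite -[RHS]inv -!mulmxA mulVmx // mulmx1.
- by move=> c x; rewrite -scalemxAl sexFZ.
- by rewrite invr_eq0.
- by rewrite dehomK // -scalemxAl /v -mulmxA mulmxK.
- exact: germ.
Qed.

End Coordinates.

Ltac hol_tac := repeat first [exact: hol_coord | exact: hol_cst | apply: holD
  | apply: holN | apply: holM | apply: holX].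

Section BasePoints.
Variable K : numClosedFieldType.
Implicit Types (s t X x y z w : K).

(** For either root X, (X - 2) / 4 and - X / 4 are cos (2 pi / 5) and cos (4 pi / 5) in some order;
    each quadratic factor is a pair of lines exchanged by y -> - y. *)
Lemma sext_lines s t X x y z w : X ^+ 2 = 2 * X + 4 ->
  sext s t (x + 'i * y) (x - 'i * y) z w =
  z * (x - z) * (((X - 2) / 4 * x - z) ^+ 2 - (1 - ((X - 2) / 4) ^+ 2) * y ^+ 2) *
  ((X / 4 * x + z) ^+ 2 - (1 - (X / 4) ^+ 2) * y ^+ 2)
  - (s * (x ^+ 2 + y ^+ 2) + t * z ^+ 2 + w ^+ 2) ^+ 3.
Proof.
move=> X2; have i2 : 'i ^+ 2 = -1 :> K by rewrite sqrCi.
have -> : x ^+ 2 + y ^+ 2 = (x + 'i * y) * (x - 'i * y) by ring: i2.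
by rewrite /sext; congr (_ - _); field: X2 i2.
Qed.

(** The zeros of the factors met at the nodes: X - 1 comes from the line x = z, while (X + 4) / 8
    and (6 - X) / 8 are 1 minus the squared cosines. *)
Lemma node_abs_neq X n : X ^+ 2 = 2 * X + 4 -> (n = 1) \/ (n = 6) \/ (n = - 4) ->
  X - n != 0.
Proof.
move=> X2 hn; apply/eqP => /eqP; rewrite subr_eq0 => /eqP Xn.
move: X2 => /eqP; rewrite Xn -subr_eq0 => /eqP.
have nz (m : nat) : m.+1%:R <> 0 :> K by apply/eqP; rewrite pnatr_eq0.
case: hn => [->|[->|->]] h.
- by apply: (nz 4); rewrite -[RHS]oppr0 -h; ring.
- by apply: (nz 19); rewrite -h; ring.
- by apply: (nz 19); rewrite -h; ring.
Qed.

(** The norm p^2 + 15 q^2 is a nonzero integer. *)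
Lemma th_lin_neq0 (th : K) (p q : int) : th ^+ 2 = -15 ->
  q != 0 -> p%:~R + q%:~R * th != 0.
Proof.
move=> th2 q0; have : p ^+ 2 + 15 * q ^+ 2 != 0.
  by rewrite gt_eqF // ltr_wpDl ?sqr_ge0 // mulr_gt0 // lt_def sqr_ge0 expf_neq0.
apply: contraNneq => h.
have : (p ^+ 2 + 15 * q ^+ 2)%:~R = (p%:~R + q%:~R * th) * (p%:~R - q%:~R * th) :> K.
  by ring: th2.
by rewrite h mul0r => /eqP; rewrite intr_eq0.
Qed.

(* The node at (X, 0, 1) is the intersection of x / X - z = +- 'i y / be; in the
   coordinates (w, A, B, z) with x = X (A + z) and y = be B these two lines
   are A ^ 2 + B ^ 2 = 0. *)
Definition node_mx X (be : K) := mx4 [:: [:: 0; 0; 0; 1]; [:: X; 0; 0; 0];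
  [:: 0; be; 0; 0]; [:: X; 0; 1; 0]].

Lemma node_mx_unit X be : X != 0 -> be != 0 -> node_mx X be \in unitmx.
Proof.
move=> X0 be0.
pose N := mx4 [:: [:: 0; X^-1; 0; 0]; [:: 0; 0; be^-1; 0]; [:: 0; -1; 0; 1];
  [:: 1; 0; 0; 0]].
apply: (@unitmx_left_inv _ _ N) => v.
by apply: row4P => -[|[|[|[|//]]]] _; rewrite !mul_mx4 //=; field.
Qed.

Lemma node_base_type_A2 s t X w R : X ^+ 2 = 2 * X + 4 ->
  s * X ^+ 2 + t + w ^+ 2 = 0 -> w != 0 -> R \in unitmx ->
  (forall v, sexF s t (v *m R) = sexF s t v) ->
  type_A2_vec s t (row4 X 0 1 w *m R).
Proof.
move=> X2 q0 w0 uR inv.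
have X0 : X != 0.
  by apply: contra_eq_neq X2 => ->; rewrite expr0n mulr0 add0r eq_sym pnatr_eq0.
have X1 : 1 - ((X - 2) / 4) ^+ 2 != 0.
  have -> : 1 - ((X - 2) / 4) ^+ 2 = (X - - 4) / 8 by field: X2.
  by rewrite mulf_neq0 ?invr_eq0 ?pnatr_eq0 // node_abs_neq //; auto.
(* Normalised so that y = be B turns the y^2 term of the pair of lines into B^2; since X (X - 2) / 4
   = 1, the x part becomes A^2. *)
pose be := sqrtC (- (1 - ((X - 2) / 4) ^+ 2)^-1).
have be2 : be ^+ 2 = - (1 - ((X - 2) / 4) ^+ 2)^-1 by rewrite sqrtCK.
have be0 : be != 0 by rewrite sqrtC_eq0 oppr_eq0 invr_eq0.
have uN := node_mx_unit X0 be0.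
pose b : 'rV[K]_3 := \row_k (if k == inord 0 then w else 0).
have -> : row4 X 0 1 w = affine_chart (inord 3) b *m node_mx X be.
  apply: row4P => k k4; rewrite row4E // mul_mx4 // affine_chart_eq1 !chart3E // !mxE.
  rewrite eqxx !(negPf (inord3_neq _ _ _)) //.
  by case: k k4 => [|[|[|[|//]]]] _ /=; ring.
apply: type_A2_transport => //.
pose c (v : 'rV[K]_3) := (X * (v ord0 (inord 1) + 1) - 1) *
  ((X / 4 * (X * (v ord0 (inord 1) + 1)) + 1) ^+ 2
   - (1 - (X / 4) ^+ 2) * (be * v ord0 (inord 2)) ^+ 2).
pose Q (v : 'rV[K]_3) := s * ((X * (v ord0 (inord 1) + 1)) ^+ 2 +
  (be * v ord0 (inord 2)) ^+ 2) + t.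
have b0 : b ord0 (inord 0) = w by rewrite mxE eqxx.
have b1 : b ord0 (inord 1) = 0 by rewrite mxE (negPf (inord3_neq _ _ _)).
have b2 : b ord0 (inord 2) = 0 by rewrite mxE (negPf (inord3_neq _ _ _)).
apply: (@node_germ _ _ c Q) => //.
- by rewrite /c; hol_tac.
- by rewrite /Q; hol_tac.
- by move=> v r; rewrite /c !upd_other ?inord3_neq.
- by move=> v r; rewrite /Q !upd_other ?inord3_neq.
- have -> : c b = (X - 1) * ((X - - 4) / 2) ^+ 2.
    by rewrite /c b1 b2; field: X2.
  by rewrite mulf_neq0 ?expf_neq0 ?mulf_neq0 ?invr_eq0 ?pnatr_eq0 ?node_abs_neq //; auto.
- by rewrite b0.
- by rewrite /Q b0 b1 b2 -[RHS]q0; ring.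
move=> v; rewrite /sexF !mul_mx4 // !affine_chart_eq1 !chart3E //=.
set W := v ord0 (inord 0); set A := v ord0 (inord 1); set B := v ord0 (inord 2).
have -> : W * 0 + A * X + B * 0 + 1 * X = X * (A + 1) by ring.
have -> : W * 0 + A * 0 + B * be + 1 * 0 = be * B by ring.
have -> : W * 0 + A * 0 + B * 0 + 1 * 1 = 1 by ring.
have -> : W * 1 + A * 0 + B * 0 + 1 * 0 = W by ring.
rewrite (sext_lines _ _ _ _ _ _ X2) -/(Q v) /c -/A -/B; congr (_ - _).
  have -> : ((X - 2) / 4 * (X * (A + 1)) - 1) ^+ 2 
      - (1 - ((X - 2) / 4) ^+ 2) * (be * B) ^+ 2 = A ^+ 2 + B ^+ 2.
    have -> : (X - 2) / 4 * (X * (A + 1)) - 1 = A by field: X2.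
    have -> : (be * B) ^+ 2 = be ^+ 2 * B ^+ 2 by ring.
    by rewrite be2 mulNr mulrN opprK mulrA divff // mul1r.
  by ring.
by rewrite /Q -/A -/B; ring.
Qed.

(** Here the node is the intersection of z = 0 and x = z; a root X of the quadratic is chosen only
    to factor the other four lines. *)
Lemma infinity_base_type_A2 s t w R : w ^+ 2 = - s -> w != 0 -> R \in unitmx ->
  (forall v, sexF s t (v *m R) = sexF s t v) ->
  type_A2_vec s t (row4 0 1 0 w *m R).
Proof.
move=> w2 w0 uR inv.
have [X X2] : exists X : K, X ^+ 2 = 2 * X + 4.
  by exists (1 + sqrtC 5); have := sqrtCK (5 : K); move: (sqrtC 5) => r r5; ring: r5.
(* In the chart y = 1 this sets x = 2 A and z = A - i B, so that z (x - z) = A^2 + B^2. *)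
pose N : 'M[K]_4 := mx4 [:: [:: 0; 0; 0; 1]; [:: 2; 0; 1; 0];
  [:: 0; 0; - 'i; 0]; [:: 0; 1; 0; 0]].
have i2 : 'i ^+ 2 = -1 :> K by rewrite sqrCi.
have uN : N \in unitmx.
  pose N' := mx4 [:: [:: 0; 2^-1; - 'i / 2; 0]; [:: 0; 0; 0; 1]; [:: 0; 0; 'i; 0];
    [:: 1; 0; 0; 0]] : 'M[K]_4.
  apply: (@unitmx_left_inv _ _ N') => v.
  by apply: row4P => -[|[|[|[|//]]]] _; rewrite !mul_mx4 //=; field: i2.
pose b : 'rV[K]_3 := \row_k (if k == inord 0 then w else 0).
have -> : row4 0 1 0 w = affine_chart (inord 3) b *m N.
  apply: row4P => k k4; rewrite row4E // mul_mx4 // affine_chart_eq1 !chart3E // !mxE.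
  rewrite eqxx !(negPf (inord3_neq _ _ _)) //.
  by case: k k4 => [|[|[|[|//]]]] _ /=; ring.
apply: type_A2_transport => //.
pose x (v : 'rV[K]_3) := 2 * v ord0 (inord 1).
pose z (v : 'rV[K]_3) := v ord0 (inord 1) - 'i * v ord0 (inord 2).
pose c v := (((X - 2) / 4 * x v - z v) ^+ 2 - (1 - ((X - 2) / 4) ^+ 2)) *
  ((X / 4 * x v + z v) ^+ 2 - (1 - (X / 4) ^+ 2)).
pose Q v := s * (x v ^+ 2 + 1) + t * z v ^+ 2.
have b0 : b ord0 (inord 0) = w by rewrite mxE eqxx.
have b1 : b ord0 (inord 1) = 0 by rewrite mxE (negPf (inord3_neq _ _ _)).
have b2 : b ord0 (inord 2) = 0 by rewrite mxE (negPf (inord3_neq _ _ _)).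
apply: (@node_germ _ _ c Q) => //.
- by rewrite /c /x /z; hol_tac.
- by rewrite /Q /x /z; hol_tac.
- by move=> v r; rewrite /c /x /z !upd_other ?inord3_neq.
- by move=> v r; rewrite /Q /x /z !upd_other ?inord3_neq.
- have -> : c b = ((X - - 4) / 8) * ((- (X - 6)) / 8).
    by rewrite /c /x /z b1 b2; field: X2.
  by rewrite !mulf_neq0 ?oppr_eq0 ?invr_eq0 ?pnatr_eq0 ?node_abs_neq //; auto.
- by rewrite b0.
- by rewrite /Q /x /z b0 b1 b2 w2; ring.
move=> v; rewrite /sexF !mul_mx4 // !affine_chart_eq1 !chart3E //=.
set W := v ord0 (inord 0); set A := v ord0 (inord 1); set B := v ord0 (inord 2).
have -> : W * 0 + A * 2 + B * 0 + 1 * 0 = x v by rewrite /x -/A; ring.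
have -> : W * 0 + A * 0 + B * 0 + 1 * 1 = 1 by ring.
have -> : W * 0 + A * 1 + B * - 'i + 1 * 0 = z v by rewrite /z -/A -/B; ring.
have -> : W * 1 + A * 0 + B * 0 + 1 * 0 = W by ring.
rewrite (sext_lines _ _ _ _ _ _ X2) !expr1n /Q; congr (_ - _).
have -> : z v * (x v - z v) = A ^+ 2 + B ^+ 2 by rewrite /x /z -/A -/B; ring: i2.
by rewrite /c; ring.
Qed.

Lemma cusp_base_type_A2 s t th R : s != 0 -> s ^+ 3 = 5 * (9 + th) / 9216 ->
  th ^+ 2 = -15 -> t = - s * (17 + th) / 2 -> R \in unitmx ->
  (forall v, sexF s t (v *m R) = sexF s t v) ->
  type_A2_vec s t (row4 (cusp_abs th) 0 1 0 *m R).
Proof.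
move=> s0 s3E th2 tE uR inv.
(* Exchanges z and w, so that chart 3 is z = 1 with coordinates (x, y, w). *)
pose N : 'M[K]_4 := mx4 [:: [:: 1; 0; 0; 0]; [:: 0; 1; 0; 0];
  [:: 0; 0; 0; 1]; [:: 0; 0; 1; 0]].
have uN : N \in unitmx.
  apply: (@unitmx_left_inv _ _ N) => v.
  by apply: row4P => -[|[|[|[|//]]]] _; rewrite !mul_mx4 //=; ring.
pose b : 'rV[K]_3 := \row_k (if k == inord 0 then cusp_abs th else 0).
have -> : row4 (cusp_abs th) 0 1 0 = affine_chart (inord 3) b *m N.
  apply: row4P => k k4; rewrite row4E // mul_mx4 // affine_chart_eq1 !chart3E // !mxE.
  rewrite eqxx !(negPf (inord3_neq _ _ _)) //.
  by case: k k4 => [|[|[|[|//]]]] _ /=; ring.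
apply: type_A2_transport => //.
pose x (v : 'rV[K]_3) := v ord0 (inord 0).
pose y (v : 'rV[K]_3) := v ord0 (inord 1).
(* (x - cusp_abs th) ^ 3 divides the sextic restricted to the axis y = w = 0,
   with quotient u. *)
pose u (v : 'rV[K]_3) := (((49 / 64) + (- 31 / 576) * th) +
    ((37 / 64) + (7 / 192) * th) * x v +
    ((- 1 / 64) + (5 / 192) * th) * x v ^+ 2 +
    ((- 5 / 64) + (- 5 / 576) * th) * x v ^+ 3) / 16.
pose q0 v := s * x v ^+ 2 + t.
pose q1 v := s * (x v ^+ 2 + y v ^+ 2) + t.
(* [al] holds the coefficients of y^2, y^4, y^6 at w = 0, and [be] those of w^2, w^4, w^6. The
   leading one of [be] is -3 q^2, with q^2 = 16 s^2 th^2 at the cusp. *)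
pose al i v := if i == 0%N then
    (- 10 * x v ^+ 3 - 10 * x v ^+ 2 + 20) / 16 - 3 * s * q0 v ^+ 2
  else if i == 1%N then 5 * (x v - 1) / 16 - 3 * s ^+ 2 * q0 v else - s ^+ 3.
pose be i v := if i == 0%N then - 3 * q1 v ^+ 2
  else if i == 1%N then - 3 * q1 v else -1.
have b0 : b ord0 (inord 0) = cusp_abs th by rewrite mxE eqxx.
have b1 : b ord0 (inord 1) = 0 by rewrite mxE (negPf (inord3_neq _ _ _)).
have b2 : b ord0 (inord 2) = 0 by rewrite mxE (negPf (inord3_neq _ _ _)).
apply: (@cusp_germ _ _ u al be (cusp_abs th)) => //.
- by rewrite /u /x; hol_tac.
- by move=> i; rewrite /al /q0 /x; case: (i == 0%N); [|case: (i == 1%N)]; hol_tac.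
- by move=> i; rewrite /be /q1 /x /y; case: (i == 0%N); [|case: (i == 1%N)]; hol_tac.
- by move=> v r; rewrite /u /x !upd_other ?inord3_neq.
- by move=> v r; rewrite /u /x !upd_other ?inord3_neq.
- by move=> i v r; rewrite /al /q0 /x !upd_other ?inord3_neq.
- by move=> i v r; rewrite /al /q0 /x !upd_other ?inord3_neq.
- by move=> i v r; rewrite /be /q1 /x /y !upd_other ?inord3_neq.
- have -> : u b = 5 * (27%:~R + 19%:~R * th) / 1152.
    by rewrite /u /x b0 /cusp_abs; field: th2.
  apply: mulf_neq0; last by rewrite invr_eq0 pnatr_eq0.
  by apply: mulf_neq0; [rewrite pnatr_eq0 | exact: th_lin_neq0].
- have -> : al 0%N b = 25 * ((-7)%:~R + 33%:~R * th) / 64.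
    rewrite /al /= /q0 /x b0 -[3 * s * _]mulrA (conic_sqr s3E tE) /cusp_abs.
    by field: th2.
  apply: mulf_neq0; last by rewrite invr_eq0 pnatr_eq0.
  by apply: mulf_neq0; [rewrite pnatr_eq0 | exact: th_lin_neq0].
- have -> : be 0%N b = - 48 * s ^+ 2 * th ^+ 2.
    by rewrite /be /= /q1 /x /y b0 b1 /cusp_abs tE; field: th2.
  rewrite th2; apply: mulf_neq0; first apply: mulf_neq0.
  - by rewrite oppr_eq0 pnatr_eq0.
  - by rewrite expf_neq0.
  - by rewrite oppr_eq0 pnatr_eq0.
move=> v; rewrite /sexF !mul_mx4 // !affine_chart_eq1 !chart3E //=.
rewrite /be /al /= /u /q1 /q0 /x /y.
set V := v ord0 (inord 0); set A := v ord0 (inord 1); set B := v ord0 (inord 2).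
have -> : V * 1 + A * 0 + B * 0 + 1 * 0 = V by ring.
have -> : V * 0 + A * 1 + B * 0 + 1 * 0 = A by ring.
have -> : V * 0 + A * 0 + B * 0 + 1 * 1 = 1 by ring.
have -> : V * 0 + A * 0 + B * 1 + 1 * 0 = B by ring.
have key : (V - cusp_abs th) ^+ 3 * ((((49 / 64) + (- 31 / 576) * th) +
    ((37 / 64) + (7 / 192) * th) * V +
    ((- 1 / 64) + (5 / 192) * th) * V ^+ 2 +
    ((- 5 / 64) + (- 5 / 576) * th) * V ^+ 3) / 16) =
    (V ^+ 5 - 5 * V ^+ 4 + 20 * V ^+ 2 - 16) / 16 - (s * V ^+ 2 + t) ^+ 3.
  by rewrite (conic_cube s3E tE) /cusp_abs; field: th2.
have i2 : 'i ^+ 2 = -1 :> K by rewrite sqrCi.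
by rewrite key /sext; field: i2.
Qed.

End BasePoints.

(** * The thirty-five points *)

Section SingularPoints.
Variable K : numClosedFieldType.
Implicit Types (v : 'rV[K]_4) (z w : K).

Definition cra v := v ord0 (inord 0) + 'i * v ord0 (inord 1).
Definition crb v := v ord0 (inord 0) - 'i * v ord0 (inord 1).

Definition singv s t v := sing s t (cra v) (crb v) (v ord0 (inord 2)) (v ord0 (inord 3)).

Let i2 : 'i ^+ 2 = -1 :> K. Proof. by rewrite sqrCi. Qed.

Lemma cr_inj v (w : 'rV[K]_4) : cra v = cra w -> crb v = crb w ->
  v ord0 (inord 2) = w ord0 (inord 2) -> v ord0 (inord 3) = w ord0 (inord 3) -> v = w.
Proof.
rewrite /cra /crb => ea eb e2 e3.
have e0 : v ord0 (inord 0) = w ord0 (inord 0).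
  apply: (@mulfI _ 2); first by rewrite pnatr_eq0.
  rewrite !mulr_natl !mulr2n -{2}(subrK ('i * v ord0 (inord 1)) (v ord0 (inord 0))).
  by rewrite eb addrCA ea; ring.
apply: row4P => -[|[|[|[|//]]]] _ //.
by apply: (@mulfI _ 'i); [rewrite neq0Ci | move: ea; rewrite e0 => /addrI].
Qed.

Lemma cra_row4 x z w : cra (row4 x 0 z w) = x.
Proof. by rewrite /cra !row4E //= mulr0 addr0. Qed.

Lemma crb_row4 x z w : crb (row4 x 0 z w) = x.
Proof. by rewrite /crb !row4E //= mulr0 subr0. Qed.

Lemma craZ l v : cra (l *: v) = l * cra v.
Proof. by rewrite /cra !mxE; ring. Qed.

Lemma crbZ l v : crb (l *: v) = l * crb v.
Proof. by rewrite /crb !mxE; ring. Qed.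

Lemma singvZ s t l v : singv s t v -> singv s t (l *: v).
Proof. by move=> /singZ -/(_ l); rewrite /singv craZ crbZ !mxE. Qed.

(* Acts on (x + i y, x - i y) as diag (r, r'). *)
Definition rotm (r r' : K) : 'M[K]_4 := mx4
  [:: [:: (r + r') / 2; - 'i * (r - r') / 2; 0; 0];
      [:: 'i * (r - r') / 2; (r + r') / 2; 0; 0];
      [:: 0; 0; 1; 0]; [:: 0; 0; 0; 1]].

Lemma cra_rot r r' v : cra (v *m rotm r r') = r * cra v.
Proof. by rewrite /cra !mul_mx4 //=; field: i2. Qed.

Lemma crb_rot r r' v : crb (v *m rotm r r') = r' * crb v.
Proof. by rewrite /crb !mul_mx4 //=; field: i2. Qed.

Lemma rot2 r r' v : (v *m rotm r r') ord0 (inord 2) = v ord0 (inord 2).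
Proof. by rewrite mul_mx4 //=; ring. Qed.

Lemma rot3 r r' v : (v *m rotm r r') ord0 (inord 3) = v ord0 (inord 3).
Proof. by rewrite mul_mx4 //=; ring. Qed.

Lemma rotm_unit r r' : r * r' = 1 -> rotm r r' \in unitmx.
Proof.
move=> rr; apply: (@unitmx_left_inv _ _ (rotm r' r)) => v.
have rr' : r' * r = 1 by rewrite mulrC.
by apply: cr_inj; rewrite ?cra_rot ?crb_rot ?rot2 ?rot3 // mulrA ?rr ?rr' mul1r.
Qed.

Lemma sexF_rot s t r r' v : r ^+ 5 = 1 -> r * r' = 1 ->
  sexF s t (v *m rotm r r') = sexF s t v.
Proof.
move=> r5 rr; rewrite /sexF -/(cra _) -/(crb _) cra_rot crb_rot rot2 rot3.
exact: sext_rot.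
Qed.

Lemma singv_rot s t r r' v : r ^+ 5 = 1 -> r * r' = 1 ->
  singv s t v -> singv s t (v *m rotm r r').
Proof. by rewrite /singv cra_rot crb_rot rot2 rot3; exact: sing_rot. Qed.

Section Points.
Variables (s t th ze : K).
Hypotheses (s3E : s ^+ 3 = 5 * (9 + th) / 9216) (th2 : th ^+ 2 = -15)
  (tE : t = - s * (17 + th) / 2) (pze : 5.-primitive_root ze).

Let X1 : K := 1 + sqrtC 5.
Let X2 : K := 1 - sqrtC 5.
Let w1 : K := sqrtC (- (s * X1 ^+ 2 + t)).
Let w2 : K := sqrtC (- (s * X2 ^+ 2 + t)).
Let w3 : K := sqrtC (- s).

(** Triples (x, z, w), one for each rotation orbit. An entry with z = 0 stands for (0 : 1 : 0 : w);
    [base_vec] supplies the coordinate y = 1. *)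
Definition point_table : seq (K * K * K) :=
  [:: (X1, 1, w1); (X1, 1, - w1); (X2, 1, w2); (X2, 1, - w2);
      (cusp_abs th, 1, 0); (0, 0, w3); (0, 0, - w3)].

Definition base_vec (p : K * K * K) : 'rV[K]_4 :=
  row4 p.1.1 (if p.1.2 == 0 then 1 else 0) p.1.2 p.2.

Definition point_vec (p : K * K * K) (k : nat) : 'rV[K]_4 :=
  base_vec p *m rotm (ze ^+ k) (ze^-1 ^+ k).

Let ze5 : ze ^+ 5 = 1. Proof. exact: prim_expr_order pze. Qed.

Let ze0 : ze != 0.
Proof. by apply: contra_eq_neq ze5 => ->; rewrite expr0n /= eq_sym oner_neq0. Qed.

Let zek5 k : (ze ^+ k) ^+ 5 = 1. Proof. by rewrite exprAC ze5 expr1n. Qed.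

Let zekV k : ze ^+ k * ze^-1 ^+ k = 1.
Proof. by rewrite -exprMn mulfV // expr1n. Qed.

Let X1E : X1 ^+ 2 = 2 * X1 + 4.
Proof. by rewrite /X1; have := sqrtCK (5 : K); move: (sqrtC 5) => r r5; ring: r5. Qed.

Let X2E : X2 ^+ 2 = 2 * X2 + 4.
Proof. by rewrite /X2; have := sqrtCK (5 : K); move: (sqrtC 5) => r r5; ring: r5. Qed.

Let s_neq0 : s != 0.
Proof.
have : s ^+ 3 != 0.
  rewrite s3E -[9]/(9%:~R) -[th]mul1r -[1]/(1%:~R).
  apply: mulf_neq0; last by rewrite invr_eq0 pnatr_eq0.
  by apply: mulf_neq0; [rewrite pnatr_eq0 | exact: th_lin_neq0].
by rewrite expf_eq0.
Qed.

(** The conic misses the nodes, so each carries two distinct values of w. Otherwise th = 4 X - 9,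
    and th^2 = -15 would force X = 4, not a root of X^2 = 2 X + 4. *)
Let node_w X : X ^+ 2 = 2 * X + 4 -> s * X ^+ 2 + t != 0.
Proof.
move=> XE; have -> : s * X ^+ 2 + t = s * ((4 * X - 9 - th) / 2).
  by rewrite tE XE; field.
apply: mulf_neq0 => //; apply: mulf_neq0; last by rewrite invr_eq0 pnatr_eq0.
apply/eqP => /eqP; rewrite subr_eq0 => /eqP thE.
have X4 : X = 4.
  apply/eqP; rewrite -subr_eq0; apply/eqP.
  have : (4 * X - 9) ^+ 2 + 15 = - 40 * (X - 4) by ring: XE.
  rewrite thE th2 addNr => /esym/eqP; rewrite mulf_eq0 oppr_eq0 pnatr_eq0 /=.
  by move/eqP.
have /eqP : (4 : K) = 0.
  have XE4 := XE; rewrite X4 in XE4.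
  by transitivity ((4 : K) ^+ 2 - (2 * 4 + 4)); [ring | rewrite XE4 subrr].
by rewrite pnatr_eq0.
Qed.

Let wE X : sqrtC (- (s * X ^+ 2 + t)) ^+ 2 = - (s * X ^+ 2 + t).
Proof. by rewrite sqrtCK. Qed.

Let w3E : w3 ^+ 2 = - s. Proof. by rewrite sqrtCK. Qed.

Let X12 : X1 != X2.
Proof.
by rewrite /X1 /X2 (inj_eq (addrI _)) eq_sym eqNr sqrtC_eq0 pnatr_eq0.
Qed.

Let cusp_not_node : cusp_abs th ^+ 2 != 2 * cusp_abs th + 4.
Proof.
rewrite -subr_eq0.
have -> : cusp_abs th ^+ 2 - (2 * cusp_abs th + 4) = - 5 * (1%:~R + 1%:~R * th) / 2.
  by rewrite /cusp_abs; field: th2.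
apply: mulf_neq0; last by rewrite invr_eq0 pnatr_eq0.
by apply: mulf_neq0; [rewrite oppr_eq0 pnatr_eq0 | exact: th_lin_neq0].
Qed.

Lemma point_table_uniq : uniq point_table.
Proof.
have eqN (w : K) : (w == - w) = (w == 0) by rewrite eq_sym eqNr.
have c1 : (X1 == cusp_abs th) = false.
  by apply: contraNF cusp_not_node => /eqP <-; apply/eqP.
have c2 : (X2 == cusp_abs th) = false.
  by apply: contraNF cusp_not_node => /eqP <-; apply/eqP.
rewrite /= !inE !xpair_eqE !eqN (negPf X12) c1 c2 !sqrtC_eq0 !oppr_eq0.
rewrite (negPf (node_w X1E)) (negPf (node_w X2E)) (negPf s_neq0) oner_eq0.
by rewrite !andbF.
Qed.

Lemma base_vec_sing p : p \in point_table -> singv s t (base_vec p).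
Proof.
have node X w : X ^+ 2 = 2 * X + 4 -> w ^+ 2 = - (s * X ^+ 2 + t) ->
    singv s t (base_vec (X, 1, w)).
  move=> XE wwE; rewrite /singv /base_vec /= oner_eq0 cra_row4 crb_row4 !row4E //=.
  exact: sing_node.
have inf w : w ^+ 2 = - s -> singv s t (base_vec (0, 0, w)).
  move=> wwE; rewrite /singv /base_vec /= eqxx /cra /crb !row4E //= mulr1 add0r sub0r.
  exact: sing_infinity.
rewrite !inE => /or4P[/eqP->|/eqP->|/eqP->|/or4P[/eqP->|/eqP->|/eqP->|/eqP->]].
- by apply: node; [exact: X1E | exact: wE].
- by apply: node; [exact: X1E | rewrite sqrrN; exact: wE].
- by apply: node; [exact: X2E | exact: wE].
- by apply: node; [exact: X2E | rewrite sqrrN; exact: wE].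
- rewrite /singv /base_vec /= oner_eq0 cra_row4 crb_row4 !row4E //=.
  exact: sing_cusp.
- by apply: inf; exact: w3E.
- by apply: inf; rewrite sqrrN; exact: w3E.
Qed.

Lemma point_vec_sing p k : p \in point_table -> singv s t (point_vec p k).
Proof. by move=> /base_vec_sing; apply: singv_rot. Qed.

Lemma point_vec_type_A2 p k : p \in point_table -> type_A2_vec s t (point_vec p k).
Proof.
have uR := rotm_unit (zekV k).
have inv v := sexF_rot s t v (zek5 k) (zekV k).
have node X w : X ^+ 2 = 2 * X + 4 -> w ^+ 2 = - (s * X ^+ 2 + t) ->
    type_A2_vec s t (point_vec (X, 1, w) k).
  move=> XE wwE; rewrite /point_vec /base_vec /= oner_eq0.
  apply: node_base_type_A2 => //; first by rewrite wwE subrr.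
  by rewrite -sqrf_eq0 wwE oppr_eq0 node_w.
have inf w : w ^+ 2 = - s -> type_A2_vec s t (point_vec (0, 0, w) k).
  move=> wwE; rewrite /point_vec /base_vec /= eqxx.
  apply: infinity_base_type_A2 => //.
  by rewrite -sqrf_eq0 wwE oppr_eq0.
rewrite !inE => /or4P[/eqP->|/eqP->|/eqP->|/or4P[/eqP->|/eqP->|/eqP->|/eqP->]].
- by apply: node; [exact: X1E | exact: wE].
- by apply: node; [exact: X1E | rewrite sqrrN; exact: wE].
- by apply: node; [exact: X2E | exact: wE].
- by apply: node; [exact: X2E | rewrite sqrrN; exact: wE].
- by rewrite /point_vec /base_vec /= oner_eq0; apply: (cusp_base_type_A2 s_neq0 s3E).
- by apply: inf; exact: w3E.
- by apply: inf; rewrite sqrrN; exact: w3E.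
Qed.

(** Stated for every triple, including the default of [nth], so that the enumeration is a total map
    to projective points. *)
Lemma point_vec_neq0 p k : point_vec p k != 0.
Proof.
apply/eqP => /(congr1 (mulmx^~ (invmx (rotm (ze ^+ k) (ze^-1 ^+ k))))).
rewrite mulmxK ?rotm_unit // mul0mx => /(congr1 (fun v : 'rV[K]_4 =>
  (v ord0 (inord 1), v ord0 (inord 2)))).
rewrite !row4E //= !mxE => -[]; case: eqP => // _ /eqP.
by rewrite oner_eq0.
Qed.

Lemma point_tableP p : p \in point_table ->
  p.1.2 = 1 /\ p.1.1 != 0 \/ p.1.2 = 0 /\ p.1.1 = 0.
Proof.
have node (X : K) : X ^+ 2 = 2 * X + 4 -> X != 0.
  move=> XE; have /eqP : X * (X - 2) = 4 by ring: XE.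
  by apply: contraTneq => ->; rewrite mul0r eq_sym pnatr_eq0.
have cusp : cusp_abs th != 0.
  have -> : cusp_abs th = (7%:~R + (-1)%:~R * th) / 2 by rewrite /cusp_abs; field.
  by apply: mulf_neq0; [exact: th_lin_neq0 | rewrite invr_eq0 pnatr_eq0].
rewrite !inE => /or4P[/eqP->|/eqP->|/eqP->|/or4P[/eqP->|/eqP->|/eqP->|/eqP->]] /=;
  by [left; split=> //; apply: node | left | right].
Qed.

Lemma cra_base p : cra (base_vec p) = if p.1.2 == 0 then p.1.1 + 'i else p.1.1.
Proof.
by rewrite /cra !row4E //=; case: ifP => _; rewrite ?mulr1 // mulr0 addr0.
Qed.

Lemma crb_base p : crb (base_vec p) = if p.1.2 == 0 then p.1.1 - 'i else p.1.1.
Proof.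
by rewrite /crb !row4E //=; case: ifP => _; rewrite ?mulr1 // mulr0 subr0.
Qed.

Let ze_inj k k' : (k < 5)%N -> (k' < 5)%N -> ze ^+ k = ze ^+ k' -> k = k'.
Proof.
by move=> k5 k'5 /eqP; rewrite (eq_prim_root_expr pze) !modn_small // => /eqP.
Qed.

(** The rotation invariants separate the orbits: for z = 1, ab and a^5 give X^2 and X^5, hence X. On
    z = 0 they give l^2 = l^5 = 1, hence l = 1. *)
Lemma point_vec_inj p q k k' l : p \in point_table -> q \in point_table ->
  (k < 5)%N -> (k' < 5)%N -> point_vec p k = l *: point_vec q k' -> p = q /\ k = k'.
Proof.
move=> pT qT k5 k'5 E.
have l0 : l != 0.
  by apply: contra_eq_neq E => ->; rewrite scale0r point_vec_neq0.
have := congr1 cra E; rewrite craZ !cra_rot !cra_base => Ea.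
have := congr1 crb E; rewrite crbZ !crb_rot !crb_base => Eb.
have := congr1 (fun v : 'rV[K]_4 => v ord0 (inord 2)) E.
rewrite /= [RHS]mxE !rot2 !row4E //= => E2.
have := congr1 (fun v : 'rV[K]_4 => v ord0 (inord 3)) E.
rewrite /= [RHS]mxE !rot3 !row4E //= => E3.
case: p q pT qT Ea Eb E2 E3 {E} => [[X z] w] [[X' z'] w'] /point_tableP /= pT.
move=> /point_tableP /= qT; move: (ze ^+ k) (ze ^+ k') (ze^-1 ^+ k) (ze^-1 ^+ k')
  (zek5 k) (zek5 k') (zekV k) (zekV k') (@ze_inj k k' k5 k'5).
move=> r r2 r' r2' r5 r25 rr rr2 rinj Ea Eb E2 E3.
case: pT Ea Eb E2 => [[-> X0]|[-> ->]]; case: qT => [[-> X'0]|[-> ->]];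
  rewrite ?eqxx ?oner_eq0 ?mulr1 ?mulr0 ?add0r ?sub0r => Ea Eb.
- move=> l1; move: Ea Eb E3; rewrite -l1 !mul1r => Ea Eb ->.
  have XX : X ^+ 2 = X' ^+ 2.
    transitivity ((r * X) * (r' * X)); first by rewrite mulrACA rr mul1r.
    by rewrite Ea Eb mulrACA rr2 mul1r.
  have X5 : X ^+ 5 = X' ^+ 5.
    by rewrite -[LHS]mul1r -r5 -exprMn Ea exprMn r25 mul1r.
  have XE : X = X'.
    apply: (@mulIf _ (X ^+ 4)); first by rewrite expf_neq0.
    by rewrite -exprS X5 (exprM X 2 2) XX -exprM -exprS.
  by move: Ea; rewrite XE => /(mulIf X'0) /rinj ->.
- by move=> /eqP; rewrite oner_eq0.
- by move=> /eqP; rewrite eq_sym (negPf l0).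
move=> _; have rl : r = l * r2.
  by apply: (@mulIf _ 'i); [exact: neq0Ci | rewrite Ea mulrA].
have rl' : r' = l * r2'.
  by apply: (@mulIf _ (- 'i)); [rewrite oppr_eq0 neq0Ci | rewrite Eb mulrA].
have l2 : l ^+ 2 = 1 by rewrite -rr rl rl' mulrACA rr2 mulr1.
have l5 : l ^+ 5 = 1 by rewrite -r5 rl exprMn r25 mulr1.
have l1 : l = 1 by rewrite -[RHS]l5 exprS (exprM l 2 2) l2 expr1n mulr1.
by rewrite E3 l1 mul1r; split=> //; apply: rinj; rewrite rl l1 mul1r.
Qed.

(** Rotation by ze^k multiplies a / b by ze^(2k), so a fifth root of unity must be halved in the
    exponent; 3 is the inverse of 2 modulo 5. *)
Let half_exp x : x ^+ 5 = 1 -> exists2 k, (k < 5)%N & (ze ^+ k) ^+ 2 = x.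
Proof.
move=> /(prim_rootP pze)[i ->]; exists ((3 * i) %% 5)%N; first by rewrite ltn_mod.
rewrite -exprM; apply/eqP; rewrite (eq_prim_root_expr pze) modnMml.
by rewrite mulnAC -modnMml mul1n.
Qed.

Let pm_sqrt w x : w ^+ 2 = x -> w = sqrtC x \/ w = - sqrtC x.
Proof.
rewrite -{1}(sqrtCK x) => /eqP; rewrite eqf_sqr.
by case/orP=> /eqP; [left | right].
Qed.

Lemma singv_point v : singv s t v -> v != 0 -> exists p k l,
  [/\ p \in point_table, (k < 5)%N, l != 0 & v = l *: point_vec p k].
Proof.
move=> vS v0; have nz : [|| cra v != 0, crb v != 0, v ord0 (inord 2) != 0
    | v ord0 (inord 3) != 0].
  apply: contraNT v0; rewrite !negb_or !negbK => /and4P[/eqP a /eqP b /eqP z /eqP w].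
  by apply/eqP/cr_inj; rewrite ?a ?b ?z ?w /cra /crb !mxE ?mulr0 ?addr0 ?subr0.
have [[z0 b0 ab wE']|[z0 ab]] := sing_cases vS nz.
  set a := cra v in ab wE' *; set b := crb v in b0 ab wE' *; set w := v ord0 _ in wE' *.
  have x5 : (- (a / b)) ^+ 5 = 1.
    by rewrite exprNn exprMn ab exprVn; field.
  have [k k5 r2] := half_exp x5.
  set r := ze ^+ k in r2; have aE : a = - (r ^+ 2 * b) by rewrite r2; field.
  have r0 : r != 0 by rewrite expf_neq0.
  (* The scalar is read off from b = l (- i) / r, the rotated base vector having (a, b) = (i r, - i
     / r). *)
  have l0 : 'i * b * r != 0 by rewrite !mulf_neq0 ?neq0Ci.
  have w'2 : (w / ('i * b * r)) ^+ 2 = - s.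
    rewrite expr_div_n wE' aE !exprMn i2; field; rewrite ?b0 ?r0 //.
  have [p pT pE] : exists2 p, p \in point_table & p = (0, 0, w / ('i * b * r)).
    exists (0, 0, w / ('i * b * r)) => //.
    by have [->|->] := pm_sqrt w'2; rewrite !inE eqxx ?orbT.
  exists p, k, ('i * b * r); split=> //.
  have rV : ze^-1 ^+ k = r^-1 by rewrite exprVn.
  apply: cr_inj; rewrite ?craZ ?crbZ ?cra_rot ?crb_rot ?cra_base ?crb_base ?[RHS]mxE
    ?rot2 ?rot3 ?row4E // pE /= ?eqxx ?add0r ?sub0r.
  - by rewrite -/a -/r aE; ring: i2.
  - by rewrite -/b rV; field: i2.
  - by rewrite z0 mulr0.
  - by rewrite mulrC divfK.
set z := v ord0 (inord 2) in z0 *; set w := v ord0 (inord 3).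
have := singZ z^-1 vS; rewrite -/z -/w mulVf //.
have : (z^-1 * cra v) ^+ 5 = (z^-1 * crb v) ^+ 5 by rewrite !exprMn ab.
set a := z^-1 * cra v; set b := z^-1 * crb v => ab' vS'.
have [k k5 [X aE bE]] : exists2 k, (k < 5)%N &
    exists2 X, a = ze ^+ k * X & b = ze^-1 ^+ k * X.
  (* The centre a = b = 0 is kept as X = 0; it satisfies neither conclusion of [sing_axis], which
     rules it out. *)
  have [b0|b0] := eqVneq b 0.
    exists 0%N => //; exists 0; rewrite ?mulr0 //; apply/eqP.
    by move/eqP: ab'; rewrite b0 expr0n expf_eq0.
  have x5 : (a / b) ^+ 5 = 1 by rewrite expr_div_n ab' divff // expf_neq0.
  have [k k5 r2] := half_exp x5; exists k => //; exists (ze ^+ k * b).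
    by rewrite mulrA -expr2 r2 divfK.
  by rewrite mulrA [X in X * b]mulrC zekV mul1r.
have XS : sing s t X X 1 (z^-1 * w).
  have V5 : (ze^-1 ^+ k) ^+ 5 = 1.
    by rewrite exprVn exprVn zek5 invr1.
  have := sing_rot V5 (etrans (mulrC _ _) (zekV k)) vS'.
  by rewrite aE bE !mulrA zekV [ze^-1 ^+ k * _]mulrC zekV !mul1r.
exists (X, 1, z^-1 * w), k, z; split=> //; last first.
  apply: cr_inj; rewrite ?craZ ?crbZ ?cra_rot ?crb_rot ?cra_base ?crb_base ?[RHS]mxE
    ?rot2 ?rot3 ?row4E //= ?oner_eq0 -?aE -?bE ?mulr1 // mulrA divff // mul1r //.
have [[XE wX]|[-> ->]] := sing_axis s3E th2 tE XS; last by rewrite !inE eqxx ?orbT.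
have /eqP : (X - 1) ^+ 2 = (sqrtC 5) ^+ 2 by rewrite sqrtCK; ring: XE.
rewrite eqf_sqr !subr_eq ![_ + 1]addrC => /orP[] /eqP XX; move: wX; rewrite XX => wX;
  have [->|->] := pm_sqrt wX; by rewrite !inE eqxx ?orbT.
Qed.

Lemma singular_enumeration : exists pts : nat -> 'rV[K]_4,
  [/\ forall i, pts i != 0,
      forall i, (i < 35)%N -> singv s t (pts i) /\ type_A2_vec s t (pts i),
      forall i j l, (i < 35)%N -> (j < 35)%N -> pts i = l *: pts j -> i = j &
      forall v, singv s t v -> v != 0 ->
        exists2 i, (i < 35)%N & exists2 l, l != 0 & v = l *: pts i].
Proof.
have d7 i : (i < 35)%N -> (i %/ 5 < size point_table)%N.
  by move=> i35; rewrite /= ltn_divLR.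
have inT i : (i < 35)%N -> nth (0, 0, 0) point_table (i %/ 5) \in point_table.
  by move=> /d7; exact: mem_nth.
(* The quotient by 5 selects the base point and the remainder the rotation. *)
exists (fun i => point_vec (nth (0, 0, 0) point_table (i %/ 5)) (i %% 5)); split.
- by move=> i; exact: point_vec_neq0.
- move=> i /inT iT; split; [exact: point_vec_sing | exact: point_vec_type_A2].
- move=> i j l i35 j35 /point_vec_inj; rewrite !inT ?ltn_pmod //.
  move=> /(_ isT isT isT isT)[nij kij].
  rewrite (divn_eq i 5) (divn_eq j 5) kij; congr (_ * _ + _)%N; apply/eqP.
  by rewrite -(nth_uniq (0, 0, 0) (d7 _ i35) (d7 _ j35) point_table_uniq) nij.
- move=> v vS v0; have [p [k [l [pT k5 l0 vE]]]] := singv_point vS v0.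
  exists (index p point_table * 5 + k)%N.
    have : (index p point_table < 7)%N by rewrite -[7%N]/(size point_table) index_mem.
    move: (index _ _) => m m7; apply: (@leq_trans (m.+1 * 5)).
      by rewrite mulSn addnC ltn_add2r.
    by rewrite (leq_mul2r 5 _ 7).
  exists l => //; rewrite vE divnMDl // divn_small // addn0.
  by rewrite modnMDl modn_small // nth_index.
Qed.

End Points.
End SingularPoints.

(** * The polynomial sextic_poly *)

Section Evaluation.
Variable K : numClosedFieldType.

Lemma meval_hom_coord (v : 'I_4 -> K) j : meval v (hom_coord K j) = v (inord j).
Proof. exact: mevalXU. Qed.

Lemma mderiv_hom_coord (i j : nat) : (i < 4)%N -> (j < 4)%N ->
  mderiv (inord i) (hom_coord K j) = (i == j)%:R.
Proof.
move=> i4 j4; rewrite /hom_coord mderivX mnm1E -val_eqE /= !inordK // eq_sym.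
case: eqP => [->|_]; last by rewrite scale0r.
rewrite scale1r -[RHS](mpolyX0 4 K); congr (mpolyX K _).
by apply/mnmP => k; rewrite mnmBE subnn mnm0E.
Qed.

End Evaluation.

(** * The sextic and its gradient, with cosine and sine abstracted to [C] and [D] *)

Section PentagonSextic.
Variables (K : numClosedFieldType) (C D s t : K).
Hypotheses (C2 : C ^+ 2 = (1 - 2 * C) / 4) (D2 : D ^+ 2 = (3 + 2 * C) / 4).

Let x := hom_coord K 0.
Let y := hom_coord K 1.
Let z := hom_coord K 2.
Let w := hom_coord K 3.
Let line (a b : K) := a *: x + b *: y - z.
Let quad := s *: (x * x + y * y) + t *: (z * z) + w * w.

(** Polynomials are multiplied out factor by factor, without powers or iterated products, so that
    the product rule applies by rewriting. *)
Definition lines_sextic : mpoly 4 K :=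
  z * ((x - z) * line C D * line (2 * C ^+ 2 - 1) (2 * C * D) *
    line (2 * C ^+ 2 - 1) (- (2 * C * D)) * line C (- D)) - quad * quad * quad.

(** Doubling gives the monic integral relations E^2 = 1 - E and F^2 = 3 + E, convenient for
    reduction. *)
Let E : K := 2 * C.
Let F : K := 2 * D.
Let CE : C = E / 2. Proof. by rewrite /E mulrC mulKf // pnatr_eq0. Qed.
Let DF : D = F / 2. Proof. by rewrite /F mulrC mulKf // pnatr_eq0. Qed.
Let E2 : E ^+ 2 = 1 - E. Proof. by rewrite /E exprMn C2; field. Qed.
Let F2 : F ^+ 2 = 3 + E. Proof. by rewrite /F exprMn D2 /E; field. Qed.
Let i2 : 'i ^+ 2 = -1 :> K. Proof. by rewrite sqrCi. Qed.

(* Abstracts cos (2 pi / 5), sin (2 pi / 5) and i, leaving only their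
   algebraic relations. *)
Ltac pentagon_field := rewrite ?CE ?DF; move: E2 F2 i2;
  move: E F ('i : K);
  let h1 := fresh in let h2 := fresh in let h3 := fresh in
  intros ? ? ? h1 h2 h3; field: h1 h2 h3.

(** As 5 is prime, the order is 1 or 5. Order 1 would give C = 1, because (2 C - z) z = C^2 + D^2 =
    1 at z = C + i D. *)
Lemma pentagon_primitive : 5.-primitive_root (C + 'i * D).
Proof.
have z5 : (C + 'i * D) ^+ 5 = 1 by pentagon_field.
have [m pm m5] := prim_order_exists (isT : (0 < 5)%N) z5.
have /primeP[_ /(_ m m5) /orP[/eqP m1|/eqP <- //]] : prime 5 by [].
move: pm; rewrite m1 => /prim_expr_order.
rewrite expr1 => /(congr1 (fun z => (2 * C - z) * z)).
have -> : (2 * C - (C + 'i * D)) * (C + 'i * D) = C ^+ 2 + D ^+ 2 by ring: i2.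
rewrite C2 D2 mulr1.
have -> : (1 - 2 * C) / 4 + (3 + 2 * C) / 4 = 1 by field.
move=> h; have C1 : C = 1.
  have -> : C = (2 * C - 1 + 1) / 2 by field.
  by rewrite -h; field.
move: C2; rewrite C1 expr1n => /eqP; rewrite -subr_eq0.
have -> : 1 - (1 - 2 * 1) / 4 = 5 / 4 :> K by field.
by rewrite mulf_eq0 invr_eq0 !pnatr_eq0.
Qed.

Let meval_line (v : 'I_4 -> K) a b :
  meval v (line a b) = a * v (inord 0) + b * v (inord 1) - v (inord 2).
Proof. by rewrite mevalB mevalD !mevalZ !meval_hom_coord. Qed.

Let meval_quad (v : 'I_4 -> K) : meval v quad =
  s * (v (inord 0) ^+ 2 + v (inord 1) ^+ 2) + t * v (inord 2) ^+ 2 + v (inord 3) ^+ 2.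
Proof.
by rewrite !mevalD !mevalZ !mevalD !mevalM !meval_hom_coord !expr2.
Qed.

Lemma meval_lines_sextic (v : 'rV[K]_4) :
  meval (v ord0) lines_sextic = sexF s t v.
Proof.
rewrite mevalB !mevalM !meval_line !meval_quad mevalB !meval_hom_coord /sexF /sext.
by pentagon_field.
Qed.

(** The chain rule: f_x = f_a + f_b and f_y = i (f_a - f_b). *)
Lemma meval_mderiv_lines_sextic (v : 'rV[K]_4) (k : nat) : (k < 4)%N ->
  meval (v ord0) (mderiv (inord k) lines_sextic) =
  nth 0 [:: sext_da s t (cra v) (crb v) (v ord0 (inord 2)) (v ord0 (inord 3)) +
            sext_da s t (crb v) (cra v) (v ord0 (inord 2)) (v ord0 (inord 3));
            'i * (sext_da s t (cra v) (crb v) (v ord0 (inord 2)) (v ord0 (inord 3)) -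
            sext_da s t (crb v) (cra v) (v ord0 (inord 2)) (v ord0 (inord 3)));
            sext_dz s t (cra v) (crb v) (v ord0 (inord 2)) (v ord0 (inord 3));
            sext_dw s t (cra v) (crb v) (v ord0 (inord 2)) (v ord0 (inord 3))] k.
Proof.
move=> k4.
have dx (p q : mpoly 4 K) : meval (v ord0) (mderiv (inord k) (p * q)) =
    meval (v ord0) (mderiv (inord k) p) * meval (v ord0) q +
    meval (v ord0) p * meval (v ord0) (mderiv (inord k) q).
  by rewrite mderivM mevalD !mevalM.
have dline a b : meval (v ord0) (mderiv (inord k) (line a b)) =
    a * (k == 0%N)%:R + b * (k == 1%N)%:R - (k == 2)%:R.
  rewrite mderivB mderivD !mderivZ !mderiv_hom_coord // mevalB mevalD !mevalZ.
  by rewrite !rmorph_nat.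
have dcoord j : (j < 4)%N ->
    meval (v ord0) (mderiv (inord k) (hom_coord K j)) = (k == j)%:R.
  by move=> j4; rewrite mderiv_hom_coord // rmorph_nat.
have dquad : meval (v ord0) (mderiv (inord k) quad) =
    2 * (s * (v ord0 (inord 0) * (k == 0%N)%:R + v ord0 (inord 1) * (k == 1%N)%:R)
     + t * v ord0 (inord 2) * (k == 2)%:R + v ord0 (inord 3) * (k == 3)%:R).
  rewrite !mderivD !mderivZ mderivD !mevalD !mevalZ mevalD !dx !dcoord //.
  by rewrite !meval_hom_coord; ring.
rewrite mderivB mevalB !dx !dquad !dline mderivB mevalB !dcoord //.
rewrite !mevalM !meval_line !meval_quad mevalB !meval_hom_coord.
case: k k4 {dx dline dcoord dquad} => [|[|[|[|//]]]] _ /=;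
  rewrite ?mulr0n ?mulr1n /sext_da /sext_dz /sext_dw /cra /crb;
  by pentagon_field.
Qed.

End PentagonSextic.

(** * Trigonometry of the regular pentagon and the given sextic *)

Section Pentagon.
Variable R : realType.
Let K : numClosedFieldType := complex R.
Let al : R := 2 * pi / 5.
Let c : R := cos al.
Let d : R := sin al.

Let d2 : d ^+ 2 = 1 - c ^+ 2. Proof. exact: sin2cos2. Qed.

Let cos_dbl : cos (al + al) = 2 * c ^+ 2 - 1.
Proof. by rewrite cosD -!expr2 -/c -/d d2; ring. Qed.

Let sin_dbl : sin (al + al) = 2 * c * d.
Proof. by rewrite sinD -/c -/d; ring. Qed.

(* The angle al satisfies cos (2 al) = cos (3 al), and cos al <> 1. *)
Let cos_pentagon : c ^+ 2 = (1 - 2 * c) / 4.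
Proof.
have c1 : c != 1.
  apply/eqP => c1; have : al = 0.
    apply: cos_inj; rewrite ?cos0 // in_itv /= ?lexx ?pi_ge0 //.
    rewrite /al divr_ge0 ?mulr_ge0 ?pi_ge0 // ler_pdivrMr // mulrC ler_pM2l ?pi_gt0 //.
    by rewrite ler_nat.
  by apply/eqP; rewrite /al !mulf_neq0 ?invr_eq0 ?gt_eqF ?pi_gt0.
have c3 : cos (al + al) = 4 * c ^+ 3 - 3 * c.
  have -> : al + al = pi *+ 2 - (al + al + al) by rewrite /al; field.
  rewrite cosB cos2pi sin2pi mul1r mul0r addr0 cosD cos_dbl sin_dbl -/c -/d.
  have -> : 2 * c * d * d = 2 * c * d ^+ 2 by ring.
  by rewrite d2; ring.
have : (c - 1) * (4 * c ^+ 2 + 2 * c - 1) = 0.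
  transitivity (4 * c ^+ 3 - 3 * c - (2 * c ^+ 2 - 1)); first by ring.
  by rewrite -c3 cos_dbl subrr.
move/eqP; rewrite mulf_eq0 subr_eq0 (negPf c1) /= => /eqP h.
have -> : c ^+ 2 = (4 * c ^+ 2 + 2 * c - 1 + 1 - 2 * c) / 4 by field.
by rewrite h add0r.
Qed.

Let C : K := (c%:C)%C.
Let D : K := (d%:C)%C.

Let C2 : C ^+ 2 = (1 - 2 * C) / 4.
Proof.
have <- : ((c ^+ 2)%:C)%C = C ^+ 2 by rewrite rmorphXn.
by rewrite cos_pentagon fmorph_div /= rmorphB rmorphM /= rmorph1 !rmorph_nat.
Qed.

Let D2 : D ^+ 2 = (3 + 2 * C) / 4.
Proof.
have <- : ((d ^+ 2)%:C)%C = D ^+ 2 by rewrite rmorphXn.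
by rewrite d2 rmorphB rmorphXn /= rmorph1 -/C C2; field.
Qed.

Lemma pentagon_root_unity : 5.-primitive_root (C + 'i * D).
Proof. exact: pentagon_primitive C2 D2. Qed.

Lemma pentagon_polyE :
  let x := hom_coord K 0 in let y := hom_coord K 1 in let z := hom_coord K 2 in
  pentagon_poly R = z * ((x - z) * (C *: x + D *: y - z) *
    ((2 * C ^+ 2 - 1) *: x + (2 * C * D) *: y - z) *
    ((2 * C ^+ 2 - 1) *: x + (- (2 * C * D)) *: y - z) *
    (C *: x + (- D) *: y - z)).
Proof.
move=> x y z; rewrite /pentagon_poly -/x -/y -/z; congr (_ * _).
have dbl : ((2 * c ^+ 2 - 1)%:C)%C = 2 * C ^+ 2 - 1 :> K.
  by rewrite rmorphB rmorphM rmorphXn /= rmorph1 rmorph_nat.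
have sdbl : ((2 * c * d)%:C)%C = 2 * C * D :> K.
  by rewrite !rmorphM /= rmorph_nat.
have prod5 (A : comNzRingType) (G : nat -> A) :
    \prod_(j < 5) G j = G 0%N * G 1%N * G 2 * G 3 * G 4.
  by rewrite !big_ord_recr big_ord0 /= mul1r.
rewrite (prod5 _ (fun j => ((cos (2 * pi * j%:R / 5 : R))%:C)%C *: x +
                     ((sin (2 * pi * j%:R / 5 : R))%:C)%C *: y - z)).
have a0 : 2 * pi * 0%:R / 5 = 0 :> R by rewrite mulr0 mul0r.
have a1 : 2 * pi * 1%:R / 5 = al by rewrite mulr1.
have a2 : 2 * pi * 2%:R / 5 = al + al by rewrite /al; field.
have a3 : 2 * pi * 3%:R / 5 = pi *+ 2 - (al + al) by rewrite /al; field.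
have a4 : 2 * pi * 4%:R / 5 = pi *+ 2 - al by rewrite /al; field.
rewrite a0 a1 a2 a3 a4.
have -> : ((cos (0 : R))%:C)%C = 1 :> K by rewrite cos0 rmorph1.
have -> : ((sin (0 : R))%:C)%C = 0 :> K by rewrite sin0 rmorph0.
have -> : ((cos (pi *+ 2 - (al + al)))%:C)%C = 2 * C ^+ 2 - 1 :> K.
  by rewrite cosB cos2pi sin2pi mul1r mul0r addr0 cos_dbl.
have -> : ((sin (pi *+ 2 - (al + al)))%:C)%C = - (2 * C * D) :> K.
  by rewrite sinB cos2pi sin2pi mul1r mul0r sub0r sin_dbl -sdbl; exact: rmorphN.
have -> : ((cos (pi *+ 2 - al))%:C)%C = C :> K.
  by rewrite cosB cos2pi sin2pi mul1r mul0r addr0.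
have -> : ((sin (pi *+ 2 - al))%:C)%C = - D :> K.
  by rewrite sinB cos2pi sin2pi mul1r mul0r sub0r; exact: rmorphN.
rewrite cos_dbl sin_dbl dbl sdbl -/c -/d -/C -/D.
rewrite scale1r scale0r addr0.
reflexivity.
Qed.

Lemma sextic_polyE (s t : K) : sextic_poly s t 0 = lines_sextic C D s t.
Proof.
rewrite /sextic_poly pentagon_polyE; congr (_ - _).
have cube (A : comNzRingType) (a : A) : a ^+ 3 = a * a * a by rewrite !exprSr expr0 mul1r.
rewrite cube; have -> : quadric_poly s t 0 = s *: (hom_coord K 0 * hom_coord K 0 +
    hom_coord K 1 * hom_coord K 1) + t *: (hom_coord K 2 * hom_coord K 2) +
    hom_coord K 3 * hom_coord K 3.
  by rewrite /quadric_poly scale0r addr0.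
reflexivity.
Qed.

Lemma meval_sextic (s t : K) (v : 'rV[K]_4) :
  meval (v ord0) (sextic_poly s t 0) = sexF s t v.
Proof. by rewrite sextic_polyE (meval_lines_sextic _ _ C2 D2). Qed.

(** Homogeneity reduces all vectors of the line to a single generator, and f_a, f_b are recovered
    from f_x, f_y because the change from (x, y) to (a, b) is invertible. *)
Lemma singular_atP (s t : K) (v : 'rV[K]_4) (P : projective_space K 3) :
  v != 0 -> sval P = <[v]>%VS ->
  singular_at (sextic_poly s t 0) P <-> singv s t v.
Proof.
move=> v0 PE; split=> [sg|sg u uP u0].
  have [|f0 df] := sg v _ v0; first by rewrite PE memv_line.
  have := df (inord 0); have := df (inord 1); have := df (inord 2); have := df (inord 3).
  rewrite sextic_polyE !(meval_mderiv_lines_sextic _ _ C2 D2) //= => dw dz /eqP.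
  rewrite mulf_eq0 (negPf (neq0Ci _)) /= subr_eq0 => /eqP ab /eqP.
  rewrite -ab -mulr2n mulrn_eq0 /= => /eqP a0.
  split=> //; first by rewrite -[RHS]f0 sextic_polyE (meval_lines_sextic _ _ C2 D2).
  by rewrite -ab.
move: uP; rewrite PE => /vlineP[l uE].
have [f0 a0 b0 z0 w0] : singv s t u by rewrite uE; apply: singvZ.
rewrite sextic_polyE; split; first by rewrite (meval_lines_sextic _ _ C2 D2).
move=> i; rewrite -(inord_val i) (meval_mderiv_lines_sextic _ _ C2 D2) // a0 b0 z0 w0.
by case: i => -[|[|[|[|//]]]] _ /=; rewrite ?addr0 // subrr mulr0.
Qed.

End Pentagon.

(** * Projective points and their spanning vectors *)

Section ProjectivePoints.
Variable K : fieldType.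

Lemma dim_line_eq1 (v : 'rV[K]_4) : v != 0 -> \dim <[v]> == 1%N.
Proof. by move=> v0; rewrite dim_vline v0. Qed.

Definition proj_point (v : 'rV[K]_4) (v0 : v != 0) : projective_space K 3 :=
  exist _ <[v]>%VS (dim_line_eq1 v0).

Lemma proj_pointP (P : projective_space K 3) :
  exists2 v : 'rV[K]_4, v != 0 & sval P = <[v]>%VS.
Proof.
case: P => U /= dU; exists (vpick U).
  by rewrite vpick0 -dimv_eq0 (eqP dU).
have v0 : vpick U != 0 by rewrite vpick0 -dimv_eq0 (eqP dU).
apply/esym/eqP; rewrite eqEdim dim_vline v0 (eqP dU) andbT.
by rewrite -memvE memv_pick.
Qed.

End ProjectivePoints.

Local Open Scope complex_scope.

Theorem theorem1 (R : realType) (s0 t0 : R[i])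
    (hs0 : 2 ^+ 15 * 3 ^+ 3 * s0 ^+ 6 - 2 ^+ 6 * 3 ^+ 3 * 5 * s0 ^+ 3
           + 5 ^+ 2 = 0)
    (ht0 : curve_C3 s0 t0 0) :
  ([set P | singular_at (sextic_poly s0 t0 0) P /\
           type_A_at 2 (sextic_poly s0 t0 0) P] #= `I_35)%card /\
  (forall P, singular_at (sextic_poly s0 t0 0) P ->
     type_A_at 2 (sextic_poly s0 t0 0) P).
Proof.
pose th : R[i] := 9216 / 5 * s0 ^+ 3 - 9.
have s3E : s0 ^+ 3 = 5 * (9 + th) / 9216 by rewrite /th; field.
have th2 : th ^+ 2 = -15.
  apply/eqP; rewrite -subr_eq0; apply/eqP.
  (* The factor 96 / 25 matches the leading coefficients: (9216 / 5)^2 = (96 / 25) 2^15 3^3. *)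
  transitivity (96 / 25 * (2 ^+ 15 * 3 ^+ 3 * s0 ^+ 6 - 2 ^+ 6 * 3 ^+ 3 * 5 * s0 ^+ 3
           + 5 ^+ 2)); first by rewrite /th; field.
  by rewrite hs0 mulr0.
have tE : t0 = - s0 * (17 + th) / 2.
  apply/esym/eqP; rewrite -subr_eq0; apply/eqP.
  transitivity ((5 * 0 ^+ 2 - 2 ^+ 2 * 5 * t0 - 2 ^+ 11 * 3 ^+ 2 * s0 ^+ 4
     - 2 ^+ 4 * 5 * s0) / 20); first by rewrite /th; field.
  by rewrite ht0 mul0r.
have [pts [pts0 ptsA ptsI ptsS]] :=
  singular_enumeration s3E th2 tE (pentagon_root_unity R).
pose f i := proj_point (pts0 i).
have typeA v P : type_A2_vec s0 t0 v -> sval P = <[v]>%VS ->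
    type_A_at 2 (sextic_poly s0 t0 0) P.
  move=> [i [a [[l la] germ]]] PE; exists i, a; split.
    by rewrite PE la; apply/vlineP; exists l.
  set g := (X in germ_type_A _ X _).
  have -> : g = fun b => sexF s0 t0 (affine_chart i b).
    by apply/funext => b; exact: meval_sextic.
  exact: germ.
have fP P : singular_at (sextic_poly s0 t0 0) P ->
    exists2 i, (i < 35)%N & P = f i.
  have [v v0 PE] := proj_pointP P; move=> /(singular_atP _ _ v0 PE) vS.
  have [i i35 [l l0 vE]] := ptsS v vS v0; exists i => //.
  apply: val_inj; rewrite /= PE vE; apply/eqP; rewrite eqEsubv -!memvE.
  apply/andP; split; apply/vlineP; first by exists l.
  by exists l^-1; rewrite scalerA mulVf // scale1r.
have fS i : (i < 35)%N -> singular_at (sextic_poly s0 t0 0) (f i).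
  by move=> /ptsA[iS _]; apply/(singular_atP _ _ (pts0 i)).
have sA P : singular_at (sextic_poly s0 t0 0) P ->
    type_A_at 2 (sextic_poly s0 t0 0) P.
  by move=> /fP[i /ptsA[_ iA] ->]; apply: (typeA (pts i)).
split=> //.
have -> : [set P | singular_at (sextic_poly s0 t0 0) P /\
           type_A_at 2 (sextic_poly s0 t0 0) P] = f @` `I_35.
  apply/seteqP; split=> [P [/fP[i i35 ->] _]|_ [i i35 <-]].
    by exists i.
  by split; [exact: fS | apply: sA; exact: fS].
apply: inj_card_eq => i j; rewrite !inE /= => i35 j35 /(congr1 sval) /= eqL.
have : pts i \in <[pts j]>%VS by rewrite -eqL memv_line.
by move=> /vlineP[l]; exact: ptsI.
Qed.
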